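(* Let $k$ be a field of characteristic $2$. Let $l,m\in\mathbb{N}$, let $l_1,l_2,m_1,m_2\in\mathbb{N}\setminus\{0\}$ be such that $A_{l_1}B_{l_2}^{-1}$ and $A_{m_1}B_{m_2}^{-1}$ belong to $\mathcal{W}'$ (i.e. $l_1\equiv l_2$ and $m_1\equiv m_2$ modulo $2$), and let $\rho,\sigma\in k\setminus\{0\}$. 1. (String with string.) $$\ell(M(A_l)\otimes M(B_m))=\begin{cases}1+l\#m=1+l+m & \text{if } l\perp m,\\ 2+l\#m & \text{if } l\not\perp m,\end{cases}$$ $$\ell(M(A_l)\otimes M(A_m))=\begin{cases}1+l\#m & \text{if } [l]_t=[m]_t=0 \text{ for all } 0\le t<s-1,\\ 2+l\#m & \text{otherwise,}\end{cases}$$ where $s=\min\{r\in\mathbb{N}\mid [l]_t+[m]_t\le 1 \ \forall t\ge r\}$. 2. (Band with string.) $$\ell\left(M(A_{l_1}B_{l_2}^{-1},\rho)\otimes M(A_m)\right)=\begin{cases}2+(l_1-1)\#m & \text{if } \rho=1,\ l_1=l_2,\ l_1\perp m \text{ and } l_1\perp(m-1),\\ \ell\left(M(A_{l_1}B_{l_2}^{-1})\otimes M(A_m)\right) & \text{otherwise.}\end{cases}$$ 3. (Band with band.) Let $M=M(A_{l_1}B_{l_2}^{-1},\rho)$ and $N=M(A_{m_1}B_{m_2}^{-1},\sigma)$. (a) If $l_1\ne l_2$, then $\ell(M\otimes N)=\ell\left(M(A_{l_1}B_{l_2}^{-1})\otimes N\right)$. Assume now that $l_1=l_2$ and $m_1=m_2$.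 (b) If $l_1\not\perp m_1$, $l_1\not\perp(m_1-1)$ and $(l_1-1)\not\perp m_1$, then $\ell(M\otimes N)=2+(l_1-1)\#(m_1-1)=2+l_1\#m_1$. (c) If $l_1\perp m_1$ and $(l_1-1)\perp m_1$, then $\ell(M\otimes N)=2+(l_1-1)\#(m_1-1)$ if $\sigma=1$, and $\ell(M\otimes N)=l_1+m_1+1$ otherwise. (d) If $l_1\perp m_1$ and $l_1\perp(m_1-1)$, then $\ell(M\otimes N)=2+(l_1-1)\#(m_1-1)$ if $\rho=1$, and $\ell(M\otimes N)=l_1+m_1+1$ otherwise. (e) If $(l_1-1)\perp m_1$ and $l_1\perp(m_1-1)$, then $$\ell(M\otimes N)=\begin{cases}2+(l_1-1)\#(m_1-1) & \text{if } \rho=\sigma=1,\\ l_1+m_1 & \text{if } \rho=\sigma\ne 1,\\ l_1+m_1+1 & \text{otherwise.}\end{cases}$$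
   Context: $\mathbb{N}$ contains $0$. For $n\in\mathbb{N}$, $[n]_i$ denotes the $i$th binary digit, $n=\sum_i[n]_i2^i$. For $l,m\in\mathbb{N}$, $l\perp m$ means $[l]_i+[m]_i\le 1$ for all $i\in\mathbb{N}$ (for $m=0$, the condition $l\perp(m-1)$ is understood to fail). Operation $\#$: given $l,m\in\mathbb{N}$, let $s\in\mathbb{N}$ be the smallest number such that $[l]_r+[m]_r\le 1$ for all $r\ge s$; put $\lambda=\sum_{i\ge s}[l]_i2^i$, $\mu=\sum_{i\ge s}[m]_i2^i$; then $l\#m=\lambda+\mu+2^s-1$. Modules. For a $2$-power $q\ge 2$, $D_{4q}=\langle g,h\mid g^2=h^2=(gh)^{2q}=1\rangle$ is the dihedral group of order $4q$. With $X=1+g$, $Y=1+h$ one has $kD_{4q}\cong k\langle X,Y\rangle/(X^2,Y^2,(XY)^q+(YX)^q)$. Modules are finite dimensional. Tensor products are over $k$ with diagonal group action, that is, $Z(m\otimes n)=Zm\otimes n+m\otimes Zn+Zm\otimes Zn$ for $Z\in\{X,Y\}$. The string and band modules below are modules over $k\langle X,Y\rangle/(X^2,Y^2)$, and each is a $kD_{4q}$-module for all sufficiently large $q$; $q$ is taken large enough that all modules considered are $kD_{4q}$-modules. $\ell(M)=\min\{n\in\mathbb{N}\mid \mathrm{rad}^n(kD_{4q})M=0\}$ is the Loewy length. Words. $\mathcal{W}$ is the set of words $a_1\cdots a_n$ ($n\ge 0$) in the letters $X,X^{-1},Y,Y^{-1}$ in which letters from $\{X,X^{-1}\}$ and $\{Y,Y^{-1}\}$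 alternate; $1$ is the empty word and $(a_1\cdots a_n)^{-1}=a_n^{-1}\cdots a_1^{-1}$. $\mathcal{W}'\subset\mathcal{W}$ is the set of words of even positive length that are not powers of a shorter word and contain letters from both $\{X,Y\}$ and $\{X^{-1},Y^{-1}\}$. Put $A_0=B_0=1$, $A_{t+1}=B_tY$, $B_{t+1}=A_tX$. String modules. For $w=a_1\cdots a_n\in\mathcal{W}$, $M(w)$ has basis $e_0,\dots,e_n$, and $Z\in\{X,Y\}$ acts by $Ze_i=e_{i-1}$ if $i>0$ and $a_i=Z$; $Ze_i=e_{i+1}$ if $i<n$ and $a_{i+1}=Z^{-1}$; $Ze_i=0$ otherwise. Band modules (scalar case). For $w=a_1\cdots a_n\in\mathcal{W}'$ and $\rho\in k\setminus\{0\}$, $M(w,\rho)$ has basis $e_0,\dots,e_{n-1}$. Let $T$ be the linear automorphism with $T(e_i)=e_{i-1}$ for $2\le i\le n-1$, $T(e_1)=\rho e_0$, $T(e_0)=e_{n-1}$, and let $a_0:=a_n$. Then $Z\in\{X,Y\}$ acts by $Ze_i=T(e_i)$ if $a_i=Z$; $Ze_i=T^{-1}(e_i)$ if $a_{i+1}=Z^{-1}$; $Ze_i=0$ otherwise. *)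

(* Defs.v *)
From HB Require Import structures.
From mathcomp Require Import all_boot all_order all_algebra.
From mathcomp Require Import all_fingroup all_solvable.
From mathcomp Require Import mxrepresentation character.
From mathcomp Require Import boolp.

Set Implicit Arguments.
Unset Strict Implicit.
Unset Printing Implicit Defensive.

Import GRing.Theory.
Local Open Scope ring_scope.

Definition digit (n i : nat) : nat := odd (n %/ 2 ^ i).

Definition perp (l m : nat) : Prop :=
  forall i : nat, (digit l i + digit m i <= 1)%N.

(* [l _|_ (m - 1)], which fails for m = 0. *)
Definition perp_pred (l m : nat) : Prop := (0 < m)%N /\ perp l m.-1.

Lemma digit_large n i : (n <= i)%N -> digit n i = 0%N.
Proof.
move=> le_ni; rewrite /digit divn_small //.
by apply: leq_ltn_trans le_ni _; apply: ltn_expl.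
Qed.

Definition carry_free_from (l m s : nat) : Prop :=
  forall r : nat, (s <= r)%N -> (digit l r + digit m r <= 1)%N.

Lemma carry_free_exists l m : exists s, `[< carry_free_from l m s >].
Proof.
exists l; apply/asboolP=> r le_lr.
by rewrite digit_large // /digit leq_b1.
Qed.

Definition carry_bound (l m : nat) : nat := ex_minn (carry_free_exists l m).

(* The sums stop at l and m because all digits of n from index n on vanish
   (digit_large).  The subtraction never truncates, as 2 ^ s >= 1. *)
Definition sharp (l m : nat) : nat :=
  let s := carry_bound l m in
  (\sum_(s <= i < l) digit l i * 2 ^ i + \sum_(s <= i < m) digit m i * 2 ^ i
   + 2 ^ s - 1)%N.

(* A letter (z, b) is Z if b = false and Z^-1 if b = true, where Z is
   the generator z. *)

Inductive gen := X | Y.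
Definition bool_of_gen z := if z is X then false else true.
Definition gen_of_bool (b : bool) := if b then Y else X.
Lemma bool_of_genK : cancel bool_of_gen gen_of_bool. Proof. by case. Qed.
HB.instance Definition _ := Equality.copy gen (can_type bool_of_genK).

Definition letter := (gen * bool)%type.
Definition word := seq letter.

Definition alternating (w : word) : bool :=
  sorted (fun a b : letter => a.1 != b.1) w.

Definition word_inv (w : word) : word :=
  rev [seq (a.1, ~~ a.2) | a <- w].

Definition word_exp (u : word) (r : nat) : word := flatten (nseq r u).

Definition in_W' (w : word) : Prop :=
  [/\ alternating w, ~~ odd (size w), (0 < size w)%N,
      forall (u : word) (r : nat),
        alternating u -> (size u < size w)%N -> w <> word_exp u r
    & has (fun a : letter => ~~ a.2) w && has (fun a : letter => a.2) w].

(* AB t = (A_t, B_t) *)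
Fixpoint AB (t : nat) : word * word :=
  if t is t'.+1 then
    (rcons (AB t').2 (Y, false), rcons (AB t').1 (X, false))
  else ([::], [::]).
Definition A_ (t : nat) : word := (AB t).1.
Definition B_ (t : nat) : word := (AB t).2.

(* a_i for w = a_1 ... a_n and 1 <= i <= n; the default is never used. *)
Definition lett (w : word) (i : nat) : letter := nth (X, false) w i.-1.

(* The i-th column of a module matrix is the image of the basis vector e_i,
   i.e., matrices act on column vectors from the left. *)

Section StringBand.

Variable k : fieldType.

Definition string_mx (w : word) (z : gen) : 'M[k]_((size w).+1) :=
  \matrix_(j, i)
    if (0 < i)%N && (lett w i == (z, false)) then (j == i.-1 :> nat)%:R
    else if (i < size w)%N && (lett w i.+1 == (z, true))
      then (j == i.+1 :> nat)%:R
    else 0.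

Definition band_T (n : nat) (rho : k) : 'M[k]_n :=
  \matrix_(j, i)
    if i == 0%N :> nat then (j == n.-1 :> nat)%:R
    else if i == 1%N :> nat then rho * (j == 0%N :> nat)%:R
    else (j == i.-1 :> nat)%:R.

(* a_i for 0 <= i <= n, with a_0 = a_n *)
Definition clett (w : word) (i : nat) : letter :=
  lett w (if i == 0%N then size w else i).

Definition band_mx (w : word) (rho : k) (z : gen) : 'M[k]_(size w) :=
  let T := band_T (size w) rho in
  \matrix_(j, i)
    if clett w i == (z, false) then T j i
    else if clett w i.+1 == (z, true) then invmx T j i
    else 0.

End StringBand.

(* The group algebra k[G] is [group_ring k G], the algebra of matrices spanned by
   the image of the regular representation; its Jacobson radical is the
   intersection of the maximal left ideals. *)

Section Loewy.

Variables (k : fieldType) (gT : finGroupType) (G : {group gT}).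

Local Notation kG := (group_ring k G).

Definition left_ideal (I : 'A[k]_#|G|) : Prop :=
  (I <= kG)%MS /\ left_mx_ideal kG I.

Definition maximal_left_ideal (I : 'A[k]_#|G|) : Prop :=
  [/\ left_ideal I, (I < kG)%MS
    & forall J : 'A[k]_#|G|,
        left_ideal J -> (I <= J)%MS -> (J < kG)%MS -> (J <= I)%MS].

Definition in_rad (a : 'M[k]_#|G|) : Prop :=
  (a \in kG)%MS /\
  forall I : 'A[k]_#|G|, maximal_left_ideal I -> (a \in I)%MS.

(* The n-th power of rad(k[G]), with rad^0 = k[G]: rad^(n+1) consists of the
   finite sums of products a b with a in rad and b in rad^n. *)
Inductive in_rad_exp : nat -> 'M[k]_#|G| -> Prop :=
| RadExp0 a of (a \in kG)%MS : in_rad_exp 0 a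
| RadExpM n a b of in_rad a & in_rad_exp n b : in_rad_exp n.+1 (a *m b)
| RadExpD n a b of in_rad_exp n.+1 a & in_rad_exp n.+1 b :
    in_rad_exp n.+1 (a + b).

(* A representation rG is regarded as the left module of column vectors, on
   which a in k[G] acts by the matrix [gring_op rG a]. *)
Definition rad_exp_kills d (rG : mx_representation k G d) (n : nat) : Prop :=
  forall a, in_rad_exp n a -> forall v : 'cV[k]_d, gring_op rG a *m v = 0.

(* The least n such that rad^n kills the module.  Such an n always exists
   because rad(k[G]) is nilpotent; the value 0 in the second branch is only
   there to make the function total. *)
Definition loewy_length d (rG : mx_representation k G d) : nat :=
  if pselect (exists n, `[< rad_exp_kills rG n >]) is left ex_n
  then ex_minn ex_n else 0%N.

End Loewy.

(* Generators g, h as in <g, h | g^2 = h^2 = (gh)^(2q) = 1>; the type 'D_(4 * q)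
   has order 4q, so no other relations hold. *)
Definition dihedral_generators (q : nat) (g h : 'D_(4 * q)) : Prop :=
  [/\ <<[set g; h]>>%g = [set: 'D_(4 * q)], (g ^+ 2 = 1)%g, (h ^+ 2 = 1)%g
    & ((g * h) ^+ (2 * q) = 1)%g].

Section DihedralModules.

Variables (k : fieldType) (q : nat) (g h : 'D_(4 * q)).

Local Notation repr d := (mx_representation k ('D_(4 * q))%G d).

(* X = 1 + g and Y = 1 + h act by M X and M Y; in particular this can hold only
   if M X and M Y satisfy the relations of k D_4q. *)
Definition XY_act d (rG : repr d) (M : gen -> 'M[k]_d) : Prop :=
  1%:M + rG g = M X /\ 1%:M + rG h = M Y.

Definition is_string_module (w : word) (rG : repr (size w).+1) : Prop :=
  XY_act rG (string_mx k w).

Definition is_band_module (w : word) (rho : k) (rG : repr (size w)) : Prop :=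
  XY_act rG (band_mx w rho).

End DihedralModules.

(* prod_repr is the tensor product over k with the diagonal group action, so
   that Z acts on it by Z (x) 1 + 1 (x) Z + Z (x) Z. *)
Notation "''l(' M ⊗ N )" := (loewy_length (prod_repr M N))
  (at level 0, M at level 39, N at level 39, format "''l(' M  ⊗  N )") : nat_scope.

(* Main.v *)
(** In characteristic 2, put g = 1 + X, h = 1 + Y, c = gh and
    alpha = 1 + c^-1, beta = 1 + c.  Up to powers of c, alpha^n X and alpha^n Y
    are the two alternating words of length n + 1, and alpha = c^-1 X + Y.  Hence
    all words of length n + 1 kill a module iff alpha^n X and alpha^(n+1) do.
    On M (x) N, alpha acts as (alpha (x) 1 + 1 (x) beta) up to a unit, so
    everything is read off the binomial expansion
      S_n = \sum_i binom(n, i) alpha^(n-i) (x) beta^i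
    and from the nilpotency of alpha on M and beta on N.  By the Lucas congruence
    binom(i + j, i) is odd iff i _|_ j, and l # m is the largest i + j with
    i <= l, j <= m and i _|_ j; thus S_n vanishes exactly from n = 1 + l # m on
    when alpha^l, beta^m are the last nonzero powers, and the Loewy length is
    1 + l # m or 2 + l # m according to whether S_(l # m) X is zero.  On the
    band module M(A_l B_l^-1, rho) one has alpha^l = (1 + rho) alpha^(l-1) X,
    which is where the conditions rho = 1 and rho = sigma come from.  If
    l1 <> l2, the string and the band module have the same annihilator, and the
    Loewy length of a tensor product depends only on annihilators. *)
Require Import Defs.
From mathcomp Require Import all_boot all_order all_algebra.
From mathcomp Require Import all_fingroup all_solvable.
From mathcomp Require Import mxrepresentation character.
From mathcomp Require Import boolp zify.

Set Implicit Arguments.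
Unset Strict Implicit.
Unset Printing Implicit Defensive.

Import GRing.Theory.

(** * Parity of binomial coefficients *)

(** The difficult half is the lower bounds, because X acts on both factors at once. The vanishing of
    [S ^+ n * X] is therefore tested where X acts on one factor only: if x2 e = 0, then X (u (x) e)
    = x1 u (x) e, and likewise X (x1 (x) 1) = x1 (x) x2. What counts is how far alpha survives on
    multiples of x1. Where B_l is nonzero, the last survivor is alpha^(l-1) x1 = B_l; on M(A_l) it
    is alpha^(l-2) x1 y1, up to a power of c. The bounds thus involve pairs that stay one or two
    below l, and they meet the upper bounds because, by Pascal's rule mod 2, l # m does not change
    when l drops by one, provided l and m are not orthogonal. The second factor carries beta instead
    of alpha because 1 + c^-1 (x) c^-1 = (1 (x) c^-1)(alpha (x) 1 + 1 (x) beta): the two summands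
    commute, and so does the unit with their sum. *)

Definition orth (a b : nat) : bool := odd 'C(a + b, a).

Lemma orthC a b : orth a b = orth b a.
Proof. by rewrite /orth -bin_sub ?leq_addr // addKn addnC. Qed.

Lemma orth0n b : orth 0 b. Proof. by rewrite /orth bin0. Qed.

Lemma orthn0 a : orth a 0. Proof. by rewrite orthC orth0n. Qed.

Lemma orthSS a b : orth a.+1 b.+1 = orth a b.+1 (+) orth a.+1 b.
Proof. by rewrite /orth addSn binS oddD addbC addnS addSn. Qed.

Lemma odd_bin2 n a : ((odd 'C(n.*2, a.*2.+1) = false) *
  (odd 'C(n.*2, a.*2) = odd 'C(n, a)))%type.
Proof.
elim: n a => [|n IHn] [|a]; rewrite ?doubleS ?bin0 //.
  by rewrite !binS !oddD (IHn 0).1 !bin0.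
split; first by rewrite !binS !oddD (IHn a).1 -doubleS (IHn a.+1).1; lia.
rewrite !binS !oddD -doubleS !(IHn _).2 (IHn a).1; lia.
Qed.

(** Lucas at the lowest binary digit: [x] and [y] are the last bits, and adding them carries exactly
    when both are set. Pascal's rule reduces each case to the even rows of [odd_bin2]. *)
Lemma orth_halfK a b (x y : bool) :
  orth (x + a.*2) (y + b.*2) = ~~ (x && y) && orth a b.
Proof.
rewrite /orth; case: x; case: y => /=; rewrite ?add0n ?add1n.
- by rewrite addSn addnS -doubleD -doubleS (odd_bin2 _ _).1.
- by rewrite addSn -doubleD binS oddD !(odd_bin2 _ _).
- by rewrite addnS -doubleD; case: a => [|a];
    rewrite ?bin0 // doubleS binS oddD -doubleS !(odd_bin2 _ _) addbF.
- by rewrite -doubleD (odd_bin2 _ _).2.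
Qed.

Lemma orth_half a b : orth a b = ~~ (odd a && odd b) && orth a./2 b./2.
Proof. by rewrite -orth_halfK !odd_double_half. Qed.

Lemma digit0 n : digit n 0 = odd n.
Proof. by rewrite /digit expn0 divn1. Qed.

Lemma digitS n i : digit n i.+1 = digit n./2 i.
Proof. by rewrite /digit expnS divnMA divn2. Qed.

Lemma perp_half l m : perp l m <-> ~~ (odd l && odd m) /\ perp l./2 m./2.
Proof.
split=> [lm | [lm0 lm] [|i]].
- split; first by have := lm 0; rewrite !digit0; case: odd; case: odd.
  by move=> i; rewrite -!digitS.
- by rewrite !digit0; case: odd lm0; case: odd.
by rewrite !digitS.
Qed.

Lemma half_ind (P : nat -> nat -> Prop) :
  P 0 0 -> (forall a b, 0 < a + b -> P a./2 b./2 -> P a b) ->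
  forall a b, P a b.
Proof.
move=> P00 IH a b; have [n] := ubnP (a + b); elim: n a b => // n IHn a b lt_n.
have [/eqP|] := posnP (a + b); first by rewrite addn_eq0 => /andP[/eqP-> /eqP->].
by move=> gt0; apply: IH => //; apply: IHn; lia.
Qed.

Lemma perpP l m : reflect (perp l m) (orth l m).
Proof.
suff H : perp l m <-> orth l m by apply: (iffP idP) => /H.
elim/half_ind: l / m => [|a b _ IH]; last first.
  by rewrite perp_half orth_half IH; split=> [[-> ->]|/andP[]].
by split=> // _ i; rewrite /digit div0n.
Qed.

Lemma carry_free_perp l m : carry_free_from l m 0 <-> perp l m.
Proof. by split=> H r //; apply: H. Qed.

Lemma carry_bound_perp l m : perp l m -> carry_bound l m = 0.
Proof.
rewrite /carry_bound => lm; case: ex_minnP => s _ /(_ 0); rewrite leqn0.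
by move=> H; apply/eqP/H/asboolP/carry_free_perp.
Qed.

Lemma carry_bound_half l m : ~ perp l m ->
  carry_bound l m = (carry_bound l./2 m./2).+1.
Proof.
move=> nlm; rewrite /carry_bound; case: ex_minnP => [[|s] /asboolP sP smin].
  by case: nlm; apply/carry_free_perp.
case: ex_minnP => t /asboolP tP tmin; apply/eqP; rewrite eqSS eqn_leq.
apply/andP; split; last first.
  by apply: tmin; apply/asboolP => r ler; rewrite -!digitS; apply: sP.
rewrite -ltnS; apply: smin; apply/asboolP => -[//|r] ler.
by rewrite !digitS; apply: tP.
Qed.

Lemma digit_sum n s u : n <= u ->
  \sum_(s <= i < u) digit n i * 2 ^ i = \sum_(s <= i < n) digit n i * 2 ^ i.
Proof.
move=> le_nu; have [le_sn|lt_ns] := leqP s n; last first.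
  rewrite [RHS]big_geq ?(ltnW lt_ns) // big_nat big1 // => i /andP[lesi _].
  by rewrite digit_large // (leq_trans _ lesi) // ltnW.
rewrite (@big_cat_nat _ _ _ n) //= -[RHS]addn0; congr (_ + _).
by rewrite big_nat big1 // => i /andP[leni _]; rewrite digit_large.
Qed.

Lemma digit_sum_half n s :
  \sum_(s.+1 <= i < n) digit n i * 2 ^ i =
  (\sum_(s <= i < n./2) digit n./2 i * 2 ^ i).*2.
Proof.
rewrite -(@digit_sum n s.+1 n.+1) // big_add1 /= -(@digit_sum n./2 s n); last lia.
by rewrite -mul2n big_distrr; apply: eq_bigr => i _; rewrite digitS expnS mulnCA.
Qed.

Lemma digit_sum0 n : \sum_(0 <= i < n) digit n i * 2 ^ i = n.
Proof.
have [m] := ubnP n; elim: m n => // m IHm [|n] ltnm; first by rewrite big_geq.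
rewrite big_ltn // digit0 expn0 muln1 digit_sum_half IHm; last lia.
by rewrite odd_double_half.
Qed.

Lemma sharp_perp l m : perp l m -> sharp l m = l + m.
Proof.
by move=> lm; rewrite /sharp carry_bound_perp // !digit_sum0 expn0 addnK.
Qed.

(** Dropping the last digit halves both sums and lowers [s] by one, and [2 ^ s - 1] is one more than
    twice [2 ^ (s - 1) - 1]. Together with [sharp_perp] this recursion determines [sharp]. *)
Lemma sharp_half l m : ~ perp l m -> sharp l m = (sharp l./2 m./2).*2.+1.
Proof.
move=> nlm; rewrite /sharp carry_bound_half // !digit_sum_half expnS.
by have := expn_gt0 2 (carry_bound l./2 m./2); lia.
Qed.

(* [sharp l m] is the largest degree in which the
   binomial expansion of (a + b) ^ n survives in k[a, b] / (a ^ l.+1, b ^ m.+1). *)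
Definition orth_le (l m n : nat) : Prop :=
  exists a b, [/\ a <= l, b <= m, orth a b & a + b = n].

(** If the maximum occurs at [a = l], then [b < m], and by Pascal's rule exactly one of [(l, b + 1)]
    and [(l - 1, b + 1)] is orthogonal; the former would exceed the maximum. The maximum [n] is
    abstract because this is used inside the induction that identifies it as [sharp]. *)
Lemma orth_le_pred_of_max l m n : ~ orth l m -> orth_le l m n ->
  (forall a b, a <= l -> b <= m -> orth a b -> a + b <= n) ->
  0 < l /\ orth_le l.-1 m n.
Proof.
move=> nlm [a [b [al bm ab <-]]] max.
have l_gt0 : 0 < l by case: l nlm {al max} => //; rewrite orth0n.
split=> //; have [lt_al|le_la] := ltnP a l; first by exists a, b; split=> //; lia.
have{al le_la} al : a = l by lia.
subst a; have lt_bm : b < m by rewrite ltn_neqAle bm andbT; apply/eqP => bm';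
  rewrite -bm' ab in nlm.
have := orthSS l.-1 b; rewrite (prednK l_gt0) ab addbT.
case E: (orth l b.+1).
  by have := max _ _ (leqnn l) lt_bm E; lia.
by move/esym/negbFE => E'; exists l.-1, b.+1; split=> //; lia.
Qed.

(** Both claims go into one induction: attaining the value at [l], [m] uses maximality at [l./2],
    [m./2]. *)
Lemma sharp_max_attained l m :
  (forall a b, a <= l -> b <= m -> orth a b -> a + b <= sharp l m) /\
  orth_le l m (sharp l m).
Proof.
elim/half_ind: l / m => [|l m _ [max ex]].
  split=> [a b|]; first by rewrite !leqn0 => /eqP-> /eqP->.
  by exists 0, 0; rewrite orth0n sharp_perp //; apply/perpP; rewrite orth0n.
have [lm|nlm] := pselect (perp l m).
  rewrite sharp_perp //; split=> [a b al bm _|]; first lia.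
  by exists l, m; split=> //; apply/perpP.
rewrite sharp_half //; split=> [a b al bm|].
  rewrite orth_half => /andP[nab ab].
  have := max _ _ (half_leq al) (half_leq bm) ab.
  by move: (odd_double_half a) (odd_double_half b) nab; case: odd;
    case: odd => /=; lia.
(* If only the last digits collide, giving up one of these two bits already yields the maximum
   [l + m - 1]. *)
have [lm2|/negP nlm2] := boolP (orth l./2 m./2).
  have /andP[ol om] : odd l && odd m.
    apply: contra_notT nlm => nolm; apply/perpP; by rewrite orth_half nolm lm2.
  have := odd_double_half l; have := odd_double_half m; rewrite ol om => m2 l2.
  exists (true + l./2.*2), (false + m./2.*2).
  rewrite orth_halfK lm2 (sharp_perp (perpP _ _ lm2)); split=> //=; lia.
(* The odd sum needs one last bit, which is given to [a]; taking [a] below [l./2] leaves room for it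
   even if [l] is even. *)
have [l_gt0 [a [b [al bm ab <-]]]] := orth_le_pred_of_max nlm2 ex max.
exists (true + a.*2), (false + b.*2); rewrite orth_halfK ab.
by split=> //=; move: (odd_double_half l) (odd_double_half m); lia.
Qed.

Lemma sharp_max l m a b : a <= l -> b <= m -> orth a b -> a + b <= sharp l m.
Proof. exact: (sharp_max_attained l m).1. Qed.

Lemma sharp_attained l m : orth_le l m (sharp l m).
Proof. exact: (sharp_max_attained l m).2. Qed.

Lemma sharp_orth l m : orth l m -> sharp l m = l + m.
Proof. by move/perpP/sharp_perp. Qed.

Lemma sharpC l m : sharp l m = sharp m l.
Proof.
have H x y : sharp x y <= sharp y x.
  have [a [b [al bm ab <-]]] := sharp_attained x y.
  by rewrite addnC; apply: sharp_max; rewrite // orthC.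
by apply/eqP; rewrite eqn_leq !H.
Qed.

Lemma sharp_leq l m l' m' : l <= l' -> m <= m' -> sharp l m <= sharp l' m'.
Proof.
move=> ll mm; have [a [b [al bm ab <-]]] := sharp_attained l m.
by apply: sharp_max => //; [apply: leq_trans ll | apply: leq_trans mm].
Qed.

Lemma orth_le_pred l m : ~~ orth l m -> 0 < l /\ orth_le l.-1 m (sharp l m).
Proof.
move=> /negP nlm; apply: orth_le_pred_of_max nlm (sharp_attained l m) _.
by move=> a b; apply: sharp_max.
Qed.

Lemma sharp_predl l m : ~~ orth l m -> sharp l.-1 m = sharp l m.
Proof.
case/orth_le_pred=> l_gt0 [a [b [al bm ab E]]].
by apply/eqP; rewrite eqn_leq sharp_leq ?leq_pred // -E sharp_max.
Qed.

Lemma sharp_predr l m : ~~ orth l m -> sharp l m.-1 = sharp l m.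
Proof. by rewrite orthC sharpC => /sharp_predl->; rewrite sharpC. Qed.

Lemma orth_pred l m : 0 < l -> 0 < m -> orth l m = orth l.-1 m (+) orth l m.-1.
Proof. by case: l => // l; case: m => // m _ _; apply: orthSS. Qed.

(** Decides whether a maximal pair can stay two below [l]. From [(l - 1, b)] with [b < m], Pascal's
    rule moves on to [(l - 2, b + 1)]. Only the corner [(l - 1, m)] is stuck, and then [(l, m - 1)]
    is orthogonal as well. *)
Lemma orth_le_pred2 l m : ~~ orth l m ->
  (0 < l) && (0 < m) /\
  ((exists a b, [/\ a.+2 <= l, b <= m, orth a b & a + b = sharp l m]) \/
   [/\ orth l.-1 m, orth l m.-1 & sharp l m = l + m - 1]).
Proof.
move=> nlm; have [l_gt0 [a [b [al bm ab E]]]] := orth_le_pred nlm.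
have m_gt0 : 0 < m by case: m nlm {bm E} => //; rewrite orthn0.
rewrite l_gt0 m_gt0; split=> //.
have [lt_al|le_la] := ltnP a l.-1; first by left; exists a, b; split=> //; lia.
have{al le_la} al : a = l.-1 by lia.
subst a; have [lt_bm|le_mb] := ltnP b m.
  left; exists l.-2, b.+1.
  suff: (1 < l) && orth l.-2 b.+1 by case/andP=> l_gt1 ->; split=> //; lia.
  apply: contraLR (leqnn (sharp l m)) => H; rewrite -ltnNge -{1}E -addnS.
  apply: sharp_max; rewrite ?leq_pred //.
  case: l l_gt0 ab H {nlm E} => [|[|l]] //=.
  by move=> _ ab /negPf H; rewrite orthSS H ab.
have{bm le_mb} bm : b = m by lia.
right; rewrite bm in ab E; split=> //; last lia.
by move: nlm; rewrite orth_pred // ab addTb negbK.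
Qed.

(** Translates the digit condition into what the modules detect, by stripping last digits. *)
Lemma low_digitsP l m :
  (forall t, t < carry_bound l m - 1 -> digit l t = 0 /\ digit m t = 0) <->
  ~ (exists a b, [/\ a.+2 <= l, b <= m, orth a b & a + b = sharp l m]).
Proof.
elim/half_ind: l / m => [|l m _ IH].
  split=> [_ [a [b [//]]]|_ t].
  by rewrite carry_bound_perp //; apply/perpP; rewrite orth0n.
have [lm|/negP nlm] := boolP (orth l m).
  split=> _; last by move=> t; rewrite carry_bound_perp //; apply/perpP.
  by case=> a [b [al bm _]]; rewrite sharp_orth //; lia.
have nlmP : ~ perp l m by move/perpP.
have l2 := odd_double_half l; have m2 := odd_double_half m.
rewrite carry_bound_half // sharp_half // subn1 /=.
(* In the first case the maximum is [l + m - 1], out of reach for [a <= l - 2]. *)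
have [lm2|nlm2] := boolP (orth l./2 m./2).
  split=> _; last by move=> t; rewrite carry_bound_perp //; apply/perpP.
  case=> a [b [al bm _]]; rewrite sharp_orth //.
  have /andP[ol om] : odd l && odd m.
    by move: nlm; rewrite orth_half lm2 andbT => /negP; rewrite negbK.
  by move: l2 m2; rewrite ol om; lia.
have -> : carry_bound l./2 m./2 = (carry_bound l./2 m./2 - 1).+1.
  by rewrite carry_bound_half ?subn1 // => /perpP; apply/negP.
have [L_gt0 [a [b [al bm ab E]]]] := orth_le_pred nlm2.
have E' (a' b' : nat) (x y : bool) : a' + b' = sharp l./2 m./2 -> x + y = 1 ->
    x + a'.*2 + (y + b'.*2) = (sharp l./2 m./2).*2.+1 by move=> <-; lia.
(* An odd last digit of [l] or of [m] violates the digit condition, and it also makes room for a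
   pair two below [l]. *)
have [ol|el] := boolP (odd l).
  split=> [/(_ 0 isT)[]|[]]; first by rewrite digit0 ol.
  exists (true + a.*2), (false + b.*2); rewrite orth_halfK ab E' //.
  by move: l2 m2; rewrite ol /=; split=> //; lia.
have [om|em] := boolP (odd m).
  split=> [/(_ 0 isT)[_]|[]]; first by rewrite digit0 om.
  exists (false + a.*2), (true + b.*2); rewrite orth_halfK ab E' //.
  by move: l2 m2; rewrite (negPf el) om /=; split=> //; lia.
have -> : (forall t, t < (carry_bound l./2 m./2 - 1).+1 ->
             digit l t = 0 /\ digit m t = 0) <->
          (forall t, t < carry_bound l./2 m./2 - 1 ->
             digit l./2 t = 0 /\ digit m./2 t = 0).
  split=> [H t lt_t|H [_|t lt_t]]; first by rewrite -!digitS; apply: H.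
    by rewrite !digit0 (negPf el) (negPf em).
  by rewrite !digitS; apply: H.
rewrite IH; move: l2 m2; rewrite (negPf el) (negPf em) => l2 m2.
split=> N [a' [b' [al' bm' ab' Eab]]]; apply: N; last first.
  exists (true + a'.*2), (false + b'.*2); rewrite orth_halfK ab' E' //.
  by split=> //=; lia.
(* At the corner the required sum is [l + m - 1], which no pair with [a' + 2 <= l] reaches. *)
have [//|[o1 o2 Es]] := (orth_le_pred2 nlm2).2.
move: ab'; rewrite orth_half => /andP[nab ab'].
exfalso; have /andP[lg mg] := (orth_le_pred2 nlm2).1.
by move: nab (odd_double_half a') (odd_double_half b'); case: odd;
  case: odd => /=; lia.
Qed.

(** For [rho = 1] and equal arms, this identifies the band value with the double string value
    outside the special case. *)
Lemma sharp_pred_orth l m : 0 < l -> ~ (orth l m /\ 0 < m /\ orth l m.-1) ->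
  (if orth l m then l + m else (sharp l m).+1) = (sharp l.-1 m).+1.
Proof.
move=> l_gt0 n; case: ifPn => o; last by rewrite sharp_predl.
have o' : orth l.-1 m.
  have [->|m_gt0] := posnP m; first exact: orthn0.
  case E: (orth _ _) => //; case: n; split=> //; split=> //.
  by move: o; rewrite orth_pred // E.
by rewrite sharp_orth //; lia.
Qed.

(** * Alternating words in the dihedral algebra *)

Local Open Scope ring_scope.

(* The alternating product of n factors x and y that ends in y on the right: for
   x, y = X, Y it is A_n, and for x, y = Y, X it is B_n. *)
Fixpoint alt_word (R : pzRingType) (x y : R) (n : nat) : R :=
  if n is n'.+1 then (if odd n' then x else y) * alt_word x y n' else 1.

(** With [x = 1 + g] and [y = 1 + h] this is [1 + h g]; exchanging the arguments gives [1 + g h],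
    the beta of the overview. *)
Definition alpha (R : pzRingType) (x y : R) : R := 1 + (1 + y) * (1 + x).

Section Words.

Variables (R : pzRingType) (addxx : forall x : R, x + x = 0).

Lemma mulr1Dl (x w : R) : (1 + x) * w = w + x * w.
Proof. by rewrite mulrDl mul1r. Qed.

Lemma sqr0_inv (x : R) : x * x = 0 -> (1 + x) * (1 + x) = 1.
Proof.
by move=> xx; rewrite mulrDl mul1r mulrDr mulr1 xx addr0 -addrA addxx addr0.
Qed.

Variables (x y : R) (xx : x * x = 0) (yy : y * y = 0).
Local Notation a := (alpha x y).
Local Notation c' := ((1 + y) * (1 + x)).

Lemma cinvl : (1 + x) * (1 + y) * c' = 1.
Proof. by rewrite mulrA -(mulrA (1 + x)) (sqr0_inv yy) mulr1 sqr0_inv. Qed.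

Lemma alpha_comm : GRing.comm a c'.
Proof. by apply/commr_sym/commrD; [apply: commr1 | apply: commr_refl]. Qed.

Lemma alphaE : a = c' * x + y.
Proof.
rewrite -mulrA (mulr1Dl x) xx addr0 /alpha mulrDr mulr1 addrA [1 + (1 + y)]addrA.
by rewrite addxx add0r addrC.
Qed.

Lemma alpha_mulx (w : R) : a * (x * w) = y * (x * w).
Proof.
rewrite /alpha mulr1Dl -mulrA (mulr1Dl x) mulrA xx mul0r addr0 mulr1Dl addrA.
by rewrite addxx add0r.
Qed.

Lemma alpha_muly (w : R) : a * (y * w) = c' * (x * (y * w)).
Proof.
have -> : c' * (x * (y * w)) = (1 + y) * (x * (y * w)).
  by rewrite -mulrA (mulr1Dl x) [x * (x * _)]mulrA xx mul0r addr0.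
rewrite /alpha mulr1Dl -mulrA (mulr1Dl x) mulrDr addrA.
by rewrite (mulr1Dl y (y * w)) [y * (y * w)]mulrA yy mul0r addr0 addxx add0r.
Qed.

(** [alpha] prepends [y] to a word starting in [x] at no cost, and [x] to a word starting in [y] at
    the cost of one factor [c'], hence in every second step. *)
Lemma alphaXx n : a ^+ n * x = c' ^+ n./2 * alt_word y x n.+1.
Proof.
elim: n => [|n IHn]; first by rewrite /= mulr1.
rewrite exprS -mulrA IHn mulrA (commrX _ alpha_comm) -mulrA.
have -> : n.+1./2 = (n./2 + odd n)%N by rewrite -[LHS]uphalfE uphalf_half addnC.
rewrite exprD -mulrA; congr (_ * _).
have -> : alt_word y x n.+1 = (if odd n then y else x) * alt_word y x n by [].
have -> : alt_word y x n.+2 =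
  (if ~~ odd n then y else x) * ((if odd n then y else x) * alt_word y x n) by [].
case: odd => /=; rewrite ?expr1 ?expr0 ?mul1r; first exact: alpha_muly.
exact: alpha_mulx.
Qed.

Lemma alphaXy n : a ^+ n * y = c' ^+ (uphalf n) * alt_word x y n.+1.
Proof.
elim: n => [|n IHn]; first by rewrite /= mulr1 mul1r.
rewrite exprS -mulrA IHn mulrA (commrX _ alpha_comm) -mulrA.
have -> : uphalf n.+1 = (uphalf n + ~~ odd n)%N by rewrite uphalfE /=
  uphalf_half; lia.
rewrite exprD -mulrA; congr (_ * _).
have -> : alt_word x y n.+1 = (if odd n then x else y) * alt_word x y n by [].
have -> : alt_word x y n.+2 =
  (if ~~ odd n then x else y) * ((if odd n then x else y) * alt_word x y n) by [].
case: odd => /=; rewrite ?expr1 ?expr0 ?mul1r; first exact: alpha_mulx.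
exact: alpha_muly.
Qed.

Lemma cinvX_eq0 n (w : R) : c' ^+ n * w = 0 <-> w = 0.
Proof.
split=> [H|->]; last exact: mulr0.
elim: n H => [|n IHn]; first by rewrite mul1r.
rewrite exprS -mulrA => /(congr1 (fun z => (1 + x) * (1 + y) * z)).
by rewrite mulrA cinvl mul1r mulr0.
Qed.

Lemma alphaXx_eq0 n : a ^+ n * x = 0 <-> alt_word y x n.+1 = 0.
Proof. by rewrite alphaXx cinvX_eq0. Qed.

Lemma alphaXy_eq0 n : a ^+ n * y = 0 <-> alt_word x y n.+1 = 0.
Proof. by rewrite alphaXy cinvX_eq0. Qed.

Lemma alphaXSE n : a ^+ n.+1 = c' * (a ^+ n * x) + a ^+ n * y.
Proof.
rewrite exprSr {2}alphaE mulrDr; congr (_ + _).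
by rewrite [LHS]mulrA [RHS]mulrA (commrX n (commr_sym alpha_comm)).
Qed.

Lemma alt_word_eq0_alpha n : (alt_word x y n.+1 = 0 /\ alt_word y x n.+1 = 0) <->
  (a ^+ n * x = 0 /\ a ^+ n.+1 = 0).
Proof.
rewrite -alphaXx_eq0 -alphaXy_eq0 alphaXSE.
split=> [[H1 H2]|[H1 H2]]; split=> //; first by rewrite H1 H2 mulr0 addr0.
by rewrite -H2 H1 mulr0 add0r.
Qed.

Lemma alt_word_eq0S n : alt_word x y n = 0 -> alt_word x y n.+1 = 0.
Proof. by move=> /= ->; rewrite mulr0. Qed.


Lemma cinv_fix w : x * w = 0 -> y * w = 0 -> c' * w = w.
Proof. by move=> xw yw; rewrite -mulrA !mulrDl !mul1r xw addr0 yw addr0. Qed.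

Lemma cinvX_fix n w : x * w = 0 -> y * w = 0 -> c' ^+ n * w = w.
Proof.
move=> xw yw; elim: n => [|n IHn]; first by rewrite mul1r.
by rewrite exprSr -mulrA cinv_fix.
Qed.

(** One generator prolongs the word to a vanishing one, the other meets its own square. On such
    words [c'] is the identity, so the unit factors above disappear. *)
Lemma alt_word_socle n : alt_word x y n.+2 = 0 -> x * alt_word x y n.+1 = 0 /\
  y * alt_word x y n.+1 = 0.
Proof. by move=> /=; case: (odd n) => /= H; rewrite H !mulrA ?xx ?yy !mul0r. Qed.

Lemma alt_word_rcons n : alt_word x y n.+1 = alt_word y x n * y.
Proof.
elim: n => [|n IHn]; first by rewrite /= mulr1 mul1r.
have -> : alt_word x y n.+2 = (if odd n.+1 then x else y) * alt_word x y n.+1 by [].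
have -> : alt_word y x n.+1 = (if odd n then y else x) * alt_word y x n by [].
by rewrite IHn mulrA /=; case: odd.
Qed.

End Words.

Section Socle.

Variables (R : pzRingType) (addxx : forall x : R, x + x = 0).
Variables (x y : R) (xx : x * x = 0) (yy : y * y = 0).

(** Loewy length at most [l + 1]: the shift makes [l] a bound for the length of nonzero words, as
    for [M(A_l)]. *)
Definition loewy_le l := alt_word x y l.+1 = 0 /\ alt_word y x l.+1 = 0.

Variable l : nat.
Hypothesis xy_l : loewy_le l.

Lemma alpha_nilp : alpha x y ^+ l.+1 = 0.
Proof. by have [_] := (alt_word_eq0_alpha addxx xx yy l).1 xy_l. Qed.

Lemma alphaX_mulx : alpha x y ^+ l * x = 0.
Proof. by have [] := (alt_word_eq0_alpha addxx xx yy l).1 xy_l. Qed.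

Lemma alphaX_muly : alpha x y ^+ l * y = 0.
Proof. by apply/alphaXy_eq0; rewrite // xy_l.1. Qed.

Lemma alpha_pred_mulx : (0 < l)%N -> alpha x y ^+ l.-1 * x = alt_word y x l.
Proof.
case: l xy_l => // l' [_ H] _; have [Hy Hx] := alt_word_socle yy xx H.
by rewrite alphaXx // cinvX_fix.
Qed.

Lemma alpha_pred_muly : (0 < l)%N -> alpha x y ^+ l.-1 * y = alt_word x y l.
Proof.
case: l xy_l => // l' [H _] _; have [Hx Hy] := alt_word_socle xx yy H.
by rewrite alphaXy // cinvX_fix.
Qed.

(** Writing one factor as [alpha = c' x + y] leaves two terms, and [c'] is trivial on both since
    they are words of maximal length. *)
Lemma alphaX_socle : (0 < l)%N -> alpha x y ^+ l = alt_word y x l + alt_word x y l.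
Proof.
move=> l_gt0; rewrite -alpha_pred_mulx // -alpha_pred_muly //.
case: l xy_l l_gt0 => // l' xyl _ /=; rewrite alphaXSE // alphaXx //.
have [Hy Hx] := alt_word_socle yy xx xyl.2.
by rewrite (cinvX_fix _ Hx Hy) cinv_fix.
Qed.

End Socle.

(** * Tensor products *)

(* Kept abstract so that the results also apply with the factors exchanged. *)
Record tensor_like (k : fieldType) (d1 d2 d : nat)
    (t : 'M[k]_d1 -> 'M[k]_d2 -> 'M[k]_d) : Prop := TensorLike {
  tensDl : forall a b u, t (a + b) u = t a u + t b u;
  tensDr : forall a u v, t a (u + v) = t a u + t a v;
  tensZl : forall c a u, t (c *: a) u = c *: t a u;
  tensZr : forall c a u, t a (c *: u) = c *: t a u;
  tensM : forall a b u v, t (a * b) (u * v) = t a u * t b v;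
  tens1 : t 1 1 = 1;
  tens_neq0 : forall a u, a != 0 -> u != 0 -> t a u != 0 }.

Lemma tensor_swap (k : fieldType) d1 d2 d (t : 'M[k]_d1 -> 'M[k]_d2 -> 'M[k]_d) :
  tensor_like t -> tensor_like (fun b a => t a b).
Proof.
by case=> *; split=> // *; match goal with H : _ |- _ => apply: H end.
Qed.

Definition loewy_eq (R : pzRingType) (x y : R) (n : nat) : Prop :=
  loewy_le x y n /\ forall i, loewy_le x y i -> (n <= i)%N.

Section Tensor.

Variables (k : fieldType) (k_char2 : 2%N \in [pchar k]).

Lemma mx_addxx d (x : 'M[k]_d) : x + x = 0.
Proof. by apply/matrixP => i j; rewrite !mxE addrr_pchar2. Qed.

Lemma mulmn_odd d (x : 'M[k]_d) n : x *+ n = if odd n then x else 0.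
Proof.
rewrite -{1}(odd_double_half n) mulrnDr -muln2 mulrnA mulr2n mx_addxx addr0.
by case: odd.
Qed.

Local Notation addxx := (@mx_addxx _).

Variables (d1 d2 d : nat) (t : 'M[k]_d1 -> 'M[k]_d2 -> 'M[k]_d).
Hypothesis tP : tensor_like t.

Lemma tens0l u : t 0 u = 0.
Proof. by rewrite -(scale0r 0) (tensZl tP) scale0r. Qed.

Lemma tens0r a : t a 0 = 0.
Proof. by rewrite -(scale0r 0) (tensZr tP) scale0r. Qed.

Lemma tensX a u n : t a u ^+ n = t (a ^+ n) (u ^+ n).
Proof.
by elim: n => [|n IHn]; rewrite ?(tens1 tP) // !exprS IHn (tensM tP).
Qed.

Lemma tens_comm a u : GRing.comm (t a 1) (t 1 u).
Proof. by rewrite /GRing.comm -!(tensM tP) !mul1r !mulr1. Qed.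

Section Expand.

Variables (a u : 'M[k]_d1) (b v : 'M[k]_d2).
Local Notation S := (t a 1 + t 1 b).

Lemma expand_tens n : S ^+ n * t u v =
  \sum_(i < n.+1) t (a ^+ (n - i) * u) (b ^+ i * v) *+ orth (n - i) i.
Proof.
rewrite (exprDn_comm _ (tens_comm a b)) mulr_suml; apply: eq_bigr => i _.
rewrite mulrnAl !tensX !expr1n -!(tensM tP) mulr1 mul1r.
have le_in : (i <= n)%N by rewrite -ltnS.
by rewrite [LHS]mulmn_odd /orth subnK // bin_sub //; case: odd.
Qed.

Variables p q : nat.
Hypotheses (ap1 : a ^+ p.+1 * u = 0) (bq1 : b ^+ q.+1 * v = 0).

Lemma powl_eq0 i : (p < i)%N -> a ^+ i * u = 0.
Proof. by move=> /subnK <-; rewrite exprD -mulrA ap1 mulr0. Qed.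

Lemma powr_eq0 i : (q < i)%N -> b ^+ i * v = 0.
Proof. by move=> /subnK <-; rewrite exprD -mulrA bq1 mulr0. Qed.

Lemma expand_eq0 n : (sharp p q < n)%N -> S ^+ n * t u v = 0.
Proof.
move=> lt_n; rewrite expand_tens big1 // => i _.
have [lt_p|le_p] := ltnP p (n - i); first by rewrite powl_eq0 // tens0l mul0rn.
have [lt_q|le_q] := ltnP q i; first by rewrite powr_eq0 // tens0r mul0rn.
case o: (orth _ _); last by rewrite mulr0n.
by have := sharp_max le_p le_q o; have := ltn_ord i; lia.
Qed.

Hypotheses (ap : a ^+ p * u != 0) (bq : b ^+ q * v != 0).

(* Multiplication by a ^ (p - i) (x) b ^ (q - j) isolates the term of bidegree
   (i, j) in the binomial expansion. *)
Lemma expand_neq0 i j : (i <= p)%N -> (j <= q)%N -> orth i j ->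
  S ^+ (i + j) * t u v != 0.
Proof.
move=> le_ip le_jq o; apply: contraTneq isT => S0.
have : t (a ^+ (p - i)) (b ^+ (q - j)) * (S ^+ (i + j) * t u v) = 0.
  by rewrite S0 mulr0.
have jP : (j < (i + j).+1)%N by rewrite ltnS leq_addl.
rewrite expand_tens mulr_sumr (bigD1 (Ordinal jP)) //= big1 => [|r ne_rj].
  rewrite addr0 addnK o mulr1n -(tensM tP) !mulrA -!exprD !subnK // => /eqP.
  by rewrite (negPf (tens_neq0 tP _ _)).
rewrite mulrnAr -(tensM tP) !mulrA -!exprD.
have [lt_rj|le_jr] := ltnP r j.
  by rewrite powl_eq0 ?tens0l ?mul0rn //; lia.
rewrite powr_eq0 ?tens0r ?mul0rn //.
by move: ne_rj; rewrite -val_eqE /=; lia.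
Qed.

Lemma expand_eq0_gt n : S ^+ n * t u v = 0 -> (sharp p q < n)%N.
Proof.
move=> Sn; rewrite ltnNge; apply/negP => /subnK E.
have [i [j [le_ip le_jq o Eij]]] := sharp_attained p q.
have := expand_neq0 le_ip le_jq o.
by rewrite Eij -E exprD -mulrA Sn mulr0 eqxx.
Qed.

End Expand.

Variables (x1 y1 : 'M[k]_d1) (x2 y2 : 'M[k]_d2).
Hypotheses (xx1 : x1 * x1 = 0) (yy1 : y1 * y1 = 0).
Hypotheses (xx2 : x2 * x2 = 0) (yy2 : y2 * y2 = 0).
Local Notation X := (1 + t (1 + x1) (1 + x2)).
Local Notation Y := (1 + t (1 + y1) (1 + y2)).
Local Notation a := (alpha x1 y1).
Local Notation b := (alpha y2 x2).
Local Notation S := (t a 1 + t 1 b).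

Lemma tensor_sqr0 : X * X = 0 /\ Y * Y = 0.
Proof.
have sqr (u : 'M[k]_d1) (v : 'M[k]_d2) : u * u = 0 -> v * v = 0 ->
    (1 + t (1 + u) (1 + v)) * (1 + t (1 + u) (1 + v)) = 0.
  move=> uu vv; rewrite mulrDl mul1r mulrDr mulr1 -(tensM tP).
  by rewrite !(sqr0_inv addxx) // (tens1 tP) [t _ _ + 1]addrC addxx.
by split; apply: sqr.
Qed.

Lemma tensor_addK (u : 'M[k]_d) : 1 + (1 + u) = u.
Proof. by rewrite addrA addxx add0r. Qed.

Lemma alpha_tensor : alpha X Y = t 1 ((1 + y2) * (1 + x2)) * S.
Proof.
have cK := cinvl addxx yy2 xx2; rewrite /alpha !tensor_addK -(tensM tP).
move: cK; set c2 := (1 + y2) * _; set c2' := (1 + x2) * _;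
  set c1 := (1 + y1) * _ => cK.
rewrite mulrDr -!(tensM tP) !mul1r !mulr1 mulrDr mulr1 cK.
rewrite (tensDl tP) (tensDr tP) (tens1 tP).
by rewrite addrACA addxx add0r addrC.
Qed.

Lemma alpha_tensorX_eq0 n (w : 'M[k]_d) : alpha X Y ^+ n * w = 0 <-> S ^+ n * w = 0.
Proof.
have comm : GRing.comm (t 1 ((1 + y2) * (1 + x2))) S.
  apply: commrD; first exact/commr_sym/tens_comm.
  rewrite /GRing.comm -!(tensM tP) !mul1r; congr (t _ _).
  rewrite /alpha (mulrDr ((1 + y2) * (1 + x2))) mulr1 (mulr1Dl ((1 + x2) * _));
    congr (_ + _).
  by rewrite (cinvl addxx xx2 yy2) (cinvl addxx yy2 xx2).
rewrite alpha_tensor exprMn_comm // -mulrA tensX expr1n.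
split=> [H|->]; last exact: mulr0.
have : t 1 (((1 + x2) * (1 + y2)) ^+ n) * (t 1 (((1 + y2) * (1 + x2)) ^+ n) *
  (S ^+ n * w)) = 0.
  by rewrite H mulr0.
rewrite mulrA -(tensM tP) mulr1 -exprMn_comm; last first.
  by rewrite /GRing.comm (cinvl addxx xx2 yy2) (cinvl addxx yy2 xx2).
by rewrite (cinvl addxx xx2 yy2) expr1n (tens1 tP) mul1r.
Qed.

Lemma loewy_le_tensor n : loewy_le X Y n <-> S ^+ n * X = 0 /\ S ^+ n.+1 = 0.
Proof.
have [XX YY] := tensor_sqr0.
rewrite /loewy_le (alt_word_eq0_alpha addxx XX YY) alpha_tensorX_eq0.
by rewrite -[alpha X Y ^+ _]mulr1 alpha_tensorX_eq0 mulr1.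
Qed.

Lemma tensor_x_fixr (e : 'M[k]_d2) u : x2 * e = 0 -> X * t u e = t (x1 * u) e.
Proof.
move=> xe; rewrite mulr1Dl -(tensM tP) !mulr1Dl xe addr0 (tensDl tP).
by rewrite addrA addxx add0r.
Qed.

Lemma tensor_x_fixl (e : 'M[k]_d1) v : x1 * e = 0 -> X * t e v = t e (x2 * v).
Proof.
move=> xe; rewrite mulr1Dl -(tensM tP) !mulr1Dl xe addr0 (tensDr tP).
by rewrite addrA addxx add0r.
Qed.

Lemma tensor_mulx u v : t u v * X = t (u * x1) v + t (u * (1 + x1)) (v * x2).
Proof.
rewrite mulrDr mulr1 -(tensM tP) !mulrDr !mulr1 (tensDr tP) !(tensDl tP).
by rewrite !addrA addxx add0r.
Qed.

Lemma loewy_le_mono i n : (i <= n)%N -> loewy_le X Y i -> loewy_le X Y n.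
Proof. by move/subnK <-; elim: (n - i)%N => //= m IHm /IHm[H1 H2]; split;
  apply: alt_word_eq0S. Qed.

Variables p q : nat.
Hypotheses (ap1 : a ^+ p.+1 = 0) (bq1 : b ^+ q.+1 = 0).

Let expand1_eq0 n : (sharp p q < n)%N -> S ^+ n = 0.
Proof.
move=> lt_n; rewrite -[_ ^+ n]mulr1 -(tens1 tP).
by apply: expand_eq0 lt_n; rewrite mulr1.
Qed.

Lemma loewy_le_sharp : loewy_le X Y (sharp p q).+1.
Proof.
by apply/loewy_le_tensor; split; rewrite expand1_eq0 ?mul0r // ltnW.
Qed.

Lemma loewy_le_sharp0 : S ^+ (sharp p q) * X = 0 -> loewy_le X Y (sharp p q).
Proof. by move=> H; apply/loewy_le_tensor; split=> //; apply: expand1_eq0. Qed.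

Lemma sharp_leq_loewy i : a ^+ p != 0 -> b ^+ q != 0 -> loewy_le X Y i ->
  (sharp p q <= i)%N.
Proof.
move=> ap bq /loewy_le_tensor[_]; rewrite -[_ ^+ _]mulr1 -(tens1 tP) -ltnS.
by apply: expand_eq0_gt; rewrite ?mulr1.
Qed.

End Tensor.

Section TensorLoewy.

Variables (k : fieldType) (k_char2 : 2%N \in [pchar k]).
Local Notation addxx := (@mx_addxx _ k_char2 _).

Lemma loewy_leC (R : pzRingType) (x y : R) n : loewy_le x y n -> loewy_le y x n.
Proof. by case. Qed.

Lemma alphaX_fix d (x y e : 'M[k]_d) l : x * x = 0 -> y * y = 0 ->
  loewy_le x y l -> x * e = 0 ->
  alpha x y ^+ l * e = alt_word x y l * e /\ alpha y x ^+ l * e = alt_word x y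
    l * e.
Proof.
move=> xx yy xyl xe; case: l xyl => [|l] xyl; first by split.
have Be : alt_word y x l.+1 * e = 0 by rewrite alt_word_rcons -mulrA xe mulr0.
rewrite (alphaX_socle addxx xx yy xyl) //.
rewrite (alphaX_socle addxx yy xx (loewy_leC xyl)) //.
by rewrite !mulrDl Be addr0 add0r.
Qed.

Variables (d1 d2 d : nat) (t : 'M[k]_d1 -> 'M[k]_d2 -> 'M[k]_d).
Hypothesis tP : tensor_like t.
Variables (x1 y1 : 'M[k]_d1) (x2 y2 : 'M[k]_d2).
Hypotheses (xx1 : x1 * x1 = 0) (yy1 : y1 * y1 = 0).
Hypotheses (xx2 : x2 * x2 = 0) (yy2 : y2 * y2 = 0).
Local Notation X := (1 + t (1 + x1) (1 + x2)).
Local Notation Y := (1 + t (1 + y1) (1 + y2)).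
Local Notation a := (alpha x1 y1).
Local Notation b := (alpha y2 x2).
Local Notation S := (t a 1 + t 1 b).
Local Notation loewy_le_tensor := (loewy_le_tensor k_char2 tP xx1 yy1 xx2 yy2).

(** [S ^+ i * X = 0] is applied to [t u e], where X acts through [x1] alone; the last nonzero powers
    of alpha on [x1 u] and of beta on [e] then bound [i]. *)
Lemma loewy_le_fixr p q u e i : x2 * e = 0 ->
  a ^+ p.+1 * (x1 * u) = 0 -> b ^+ q.+1 * e = 0 ->
  a ^+ p * (x1 * u) != 0 -> b ^+ q * e != 0 ->
  loewy_le X Y i -> (sharp p q < i)%N.
Proof.
move=> xe ap1 bq1 ap bq /loewy_le_tensor[SX _].
apply: (expand_eq0_gt k_char2 tP ap1 bq1 ap bq).
by rewrite -(tensor_x_fixr k_char2 tP x1 u xe) mulrA SX mul0r.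
Qed.

Variables l m : nat.
Hypotheses (xy1 : loewy_le x1 y1 l) (xy2 : loewy_le x2 y2 m).

Let al1 : a ^+ l.+1 = 0 := alpha_nilp addxx xx1 yy1 xy1.
Let bm1 : b ^+ m.+1 = 0 := alpha_nilp addxx yy2 xx2 (loewy_leC xy2).
Let alx : a ^+ l * x1 = 0 := alphaX_mulx addxx xx1 yy1 xy1.
Let bmx : b ^+ m * x2 = 0 := alphaX_muly addxx yy2 xx2 (loewy_leC xy2).

Let powa i : (l < i)%N -> a ^+ i = 0.
Proof. by move/subnK <-; rewrite exprD al1 mulr0. Qed.

Let powb i : (m < i)%N -> b ^+ i = 0.
Proof. by move/subnK <-; rewrite exprD bm1 mulr0. Qed.

Lemma expand_top : S ^+ (l + m) = t (a ^+ l) (b ^+ m) *+ orth l m.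
Proof.
rewrite -[LHS]mulr1 -(tens1 tP) (expand_tens k_char2 tP).
have mP : (m < (l + m).+1)%N by lia.
rewrite (bigD1 (Ordinal mP)) //= addnK !mulr1 big1 ?addr0 // => i ne_im.
have [lt_im|le_mi] := ltnP i m.
  by rewrite powa ?mul0r ?(tens0l tP) ?mul0rn //; lia.
rewrite powb ?mul0r ?(tens0r tP) ?mul0rn //.
by move: ne_im; rewrite -val_eqE /=; lia.
Qed.

Lemma expand_pred : (0 < l)%N -> (0 < m)%N -> S ^+ (l + m - 1) =
  t (a ^+ l) (b ^+ m.-1) *+ orth l m.-1 + t (a ^+ l.-1) (b ^+ m) *+ orth l.-1 m.
Proof.
move=> l_gt0 m_gt0; rewrite -[LHS]mulr1 -(tens1 tP) (expand_tens k_char2 tP).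
have mP : (m < (l + m - 1).+1)%N by lia.
have mP' : (m.-1 < (l + m - 1).+1)%N by lia.
rewrite (bigD1 (Ordinal mP')) //= (bigD1 (Ordinal mP)) /=; last first.
  by rewrite -val_eqE /=; lia.
have -> : (l + m - 1 - m.-1 = l)%N by lia.
have -> : (l + m - 1 - m = l.-1)%N by lia.
rewrite !mulr1 big1 ?addr0 // => i /andP[ne1 ne2].
have [lt_im|le_mi] := ltnP i m.
  rewrite powa ?mul0r ?(tens0l tP) ?mul0rn //.
  by move: ne1; rewrite -val_eqE /=; lia.
rewrite powb ?mul0r ?(tens0r tP) ?mul0rn //.
by move: ne2; rewrite -val_eqE /=; lia.
Qed.

Lemma expand_top_mulx : S ^+ (l + m) * X = 0.
Proof.
rewrite expand_top mulrnAl (tensor_mulx k_char2 tP) alx bmx.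
by rewrite (tens0l tP) (tens0r tP) addr0 mul0rn.
Qed.

Lemma expand_pred_mulx : (0 < l)%N -> (0 < m)%N -> S ^+ (l + m - 1) * X =
  t (a ^+ l) (b ^+ m.-1 * x2) *+ orth l m.-1 +
  t (a ^+ l.-1 * x1) (b ^+ m) *+ orth l.-1 m.
Proof.
move=> l_gt0 m_gt0; rewrite expand_pred // mulrDl !mulrnAl.
rewrite !(tensor_mulx k_char2 tP) alx bmx (tens0l tP) (tens0r tP) add0r addr0.
by rewrite mulrDr mulr1 alx addr0.
Qed.

Lemma expand_gt n : (sharp l m < n)%N -> S ^+ n = 0.
Proof.
move=> lt_n; rewrite -[LHS]mulr1 -(tens1 tP).
by apply: (expand_eq0 k_char2 tP) lt_n; rewrite mulr1.
Qed.

(** This needs no orthogonality: in degree [l + m] at most the bidegree [(l, m)] remains, and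
    multiplying by X kills it because [a ^+ l * x1] and [b ^+ m * x2] vanish. *)
Lemma loewy_le_top : loewy_le X Y (l + m).
Proof.
apply/loewy_le_tensor; split; first exact: expand_top_mulx.
apply: expand_gt; have [i [j [? ? _ <-]]] := sharp_attained l m; lia.
Qed.

(** Bounds propagate upwards, so excluding all values below [l + m] takes a single test in degree
    [l + m - 1], where at most two bidegrees survive. *)
Lemma loewy_le_pred i : (i < l + m)%N -> loewy_le X Y i -> S ^+ (l + m - 1) * X = 0.
Proof.
move=> lt_i /loewy_le_mono le_i; have/le_i : (i <= l + m - 1)%N by lia.
by case/loewy_le_tensor.
Qed.

Lemma loewy_eq_orth : orth l m -> a ^+ l != 0 -> b ^+ m != 0 ->
  loewy_eq X Y (l + m).
Proof.
move=> o al bm; split=> [|i]; first exact: loewy_le_top.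
by move/(sharp_leq_loewy k_char2 tP xx1 yy1 xx2 yy2 al1 bm1 al bm);
  rewrite sharp_orth.
Qed.

Section FixRight.

Variable e : 'M[k]_d2.
Hypotheses (xe : x2 * e = 0) (Ae : alt_word x2 y2 m * e != 0).

Let bme : b ^+ m * e != 0.
Proof. by rewrite (alphaX_fix xx2 yy2 xy2 xe).2. Qed.

Let bm : b ^+ m != 0.
Proof. by apply: contraNneq bme => ->; rewrite mul0r. Qed.

Let lower i : (0 < l)%N -> alt_word y1 x1 l != 0 -> loewy_le X Y i -> (sharp
  l.-1 m < i)%N.
Proof.
move=> l_gt0 Bl; apply: (@loewy_le_fixr l.-1 m 1 e i xe).
- by rewrite mulr1 prednK.
- by rewrite bm1 mul0r.
- by rewrite mulr1 (alpha_pred_mulx addxx xx1 yy1 xy1).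
- exact: bme.
Qed.

(** Without orthogonality the lower bound [sharp l.-1 m + 1] loses nothing, by [sharp_predl]. The
    asymmetric assumptions, a B-word on the left and an A-word on the right, fit double strings and
    bands with [rho != 1] tensored with [M(A_m)], and [M(A_l)] with [M(B_m)] after exchanging the
    factors. *)
Lemma loewy_eq_string : a ^+ l != 0 -> ((0 < l)%N -> alt_word y1 x1 l != 0) ->
  loewy_eq X Y (if orth l m then l + m else (sharp l m).+1)%N.
Proof.
move=> al Bl; case: ifPn => o; first exact: loewy_eq_orth.
split=> [|i]; first exact: (loewy_le_sharp k_char2 tP xx1 yy1 xx2 yy2 al1 bm1).
have l_gt0 := (orth_le_pred o).1.
by move/(lower l_gt0 (Bl l_gt0)); rewrite sharp_predl.
Qed.

(** The case [rho = 1]: alpha has one nonzero power less, but [a ^+ l.-1 * x1] is still nonzero, so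
    both bounds use [l - 1]. *)
Lemma loewy_eq_band_string : (0 < l)%N -> alt_word y1 x1 l != 0 -> a ^+ l = 0 ->
  loewy_eq X Y (sharp l.-1 m).+1.
Proof.
move=> l_gt0 Bl al0; split=> [|i]; last exact: lower.
by apply: (loewy_le_sharp k_char2 tP) => //; rewrite prednK.
Qed.

(** Here the B-word of length [l] vanishes, so [a ^+ l.-1 * x1 = 0], and the test vector becomes
    [x1 y1 e1], on which alpha survives only up to the power [l - 2]. *)
Lemma loewy_eq_uniserial (e1 : 'M[k]_d1) : x1 * e1 = 0 -> alt_word x1 y1 l * e1
  != 0 ->
  ((0 < l)%N -> alt_word y1 x1 l = 0) -> ((0 < m)%N -> alt_word y2 x2 m = 0) ->
  let two_below := exists i j,
    [/\ i.+2 <= l, j <= m, orth i j & i + j = sharp l m]%N in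
  (two_below -> loewy_eq X Y (sharp l m).+1) /\
  (~ two_below -> loewy_eq X Y (sharp l m)).
Proof.
move=> xe1 Ae1 Bl Bm two_below.
have al : a ^+ l != 0.
  by move: Ae1; rewrite -(alphaX_fix xx1 yy1 xy1 xe1).1;
    apply: contraNneq => ->; rewrite mul0r.
have lo := sharp_leq_loewy k_char2 tP xx1 yy1 xx2 yy2 al1 bm1 al bm.
split=> [[i [j [il jm o ij]]]|no2].
  split; first exact: (loewy_le_sharp k_char2 tP).
  move=> n /(@loewy_le_fixr l.-2 m (y1 * e1) e n xe) lt_n.
  (* Up to a unit this is the A-word of length [r + 2], whence the exponents [l - 2] (nonzero) and
     [l - 1] (zero). *)
  have aX r : a ^+ r * (x1 * (y1 * e1)) =
      ((1 + y1) * (1 + x1)) ^+ r./2 * (alt_word x1 y1 r.+2 * e1).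
    by rewrite (mulrA (a ^+ r)) (alphaXx addxx xx1 yy1) (alt_word_rcons x1 y1
      r.+1) -!mulrA.
  apply: leq_ltn_trans (lt_n _ _ _ _).
  - by rewrite -ij sharp_max //; lia.
  - by rewrite aX !prednK ?xy1.1 ?mul0r ?mulr0 //; lia.
  - by rewrite bm1 mul0r.
  - rewrite aX !prednK; try lia.
    by apply: contraNneq Ae1 => /(cinvX_eq0 addxx xx1 yy1)->.
  - exact: bme.
have [o|no] := boolP (orth l m).
  by rewrite sharp_orth //; apply: loewy_eq_orth.
have [/andP[l_gt0 m_gt0] [//|[o1 o2 E]]] := orth_le_pred2 no.
split; last exact: lo; apply: (loewy_le_sharp0 k_char2 tP) => //.
(* At the corner both surviving terms contain a B-word of full length, which is zero. *)
rewrite E expand_pred_mulx // (alpha_pred_mulx addxx xx1 yy1 xy1) //.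
rewrite (alpha_pred_muly addxx yy2 xx2 (loewy_leC xy2)) // Bl // Bm //.
by rewrite (tens0l tP) (tens0r tP) !mul0rn addr0.
Qed.

End FixRight.

(** * Tensor products of two bands with equal arms *)

Section Bands.

Variables rho sigma : k.
Hypotheses (l_gt0 : (0 < l)%N) (m_gt0 : (0 < m)%N).
Hypotheses (Bl : alt_word y1 x1 l != 0) (Al : alt_word x1 y1 l = rho *:
  alt_word y1 x1 l).
Hypotheses (Bm : alt_word y2 x2 m != 0) (Am : alt_word x2 y2 m = sigma *:
  alt_word y2 x2 m).

Let alE : a ^+ l = (1 + rho) *: alt_word y1 x1 l.
Proof. by rewrite (alphaX_socle addxx xx1 yy1 xy1) // Al scalerDl scale1r. Qed.

Let bmE : b ^+ m = (1 + sigma) *: alt_word y2 x2 m.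
Proof.
by rewrite (alphaX_socle addxx yy2 xx2 (loewy_leC xy2)) // Am addrC scalerDl
  scale1r.
Qed.

Let apx : a ^+ l.-1 * x1 = alt_word y1 x1 l.
Proof. exact: (alpha_pred_mulx addxx xx1 yy1 xy1). Qed.

Let bpx : b ^+ m.-1 * x2 = alt_word y2 x2 m.
Proof. exact: (alpha_pred_muly addxx yy2 xx2 (loewy_leC xy2)). Qed.

Let add1_eq0 (c : k) : (1 + c == 0) = (c == 1).
Proof. by rewrite addrC addr_eq0 oppr_pchar2. Qed.

Let add_eq0 (c c' : k) : (c + c' == 0) = (c == c').
Proof. by rewrite addr_eq0 oppr_pchar2. Qed.

(** As [x1 * x1 = 0], X maps [t x1 1] to [t x1 x2]. The last nonzero powers on [x1] and [x2] have
    exponents [l - 1] and [m - 1], giving the two B-words. *)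
Let bands_lower i : loewy_le X Y i -> (sharp l.-1 m.-1 < i)%N.
Proof.
case/loewy_le_tensor => SX _.
apply: (@expand_eq0_gt _ k_char2 _ _ _ _ tP a x1 b x2 l.-1 m.-1).
- by rewrite prednK.
- by rewrite prednK.
- by rewrite apx.
- by rewrite bpx.
have -> : t x1 x2 = X * t x1 1 by rewrite (tensor_x_fixl k_char2 tP x2 1 xx1) mulr1.
by rewrite mulrA SX mul0r.
Qed.

Lemma loewy_eq_bands_nonorth : ~~ orth l m -> ~~ orth l.-1 m ->
  sharp l.-1 m.-1 = sharp l m /\ loewy_eq X Y (sharp l m).+1.
Proof.
move=> o o';
  have E : sharp l.-1 m.-1 = sharp l m by rewrite sharp_predr // sharp_predl.
split=> //; split=> [|i /bands_lower]; last by rewrite E.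
exact: (loewy_le_sharp k_char2 tP).
Qed.

(** Pascal's rule excludes [orth l m.-1], so in degree [l + m - 1] a single term remains,
    [1 + sigma] times the product of the B-words. For [sigma = 1] beta has one nonzero power less,
    and lowering [l] as well changes nothing. *)
Lemma loewy_eq_bands_orth : orth l m -> orth l.-1 m ->
  loewy_eq X Y (if sigma == 1%R then (sharp l.-1 m.-1).+1 else l + m)%N.
Proof.
move=> o o'; have no : ~~ orth l m.-1 by move: o; rewrite orth_pred // o' addTb.
case: ifPn => sigma1; last first.
  split=> [|i le_i]; first exact: loewy_le_top.
  rewrite leqNgt; apply: contraT; rewrite negbK => /loewy_le_pred/(_ le_i)/eqP.
  rewrite expand_pred_mulx // (negPf no) o' mulr0n add0r mulr1n apx bmE (tensZr tP).
  by rewrite scaler_eq0 add1_eq0 (negPf sigma1) (negPf (tens_neq0 tP Bl Bm)).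
split=> [|i]; last exact: bands_lower.
rewrite sharp_predl //; apply: (loewy_le_sharp k_char2 tP) => //.
by rewrite prednK // bmE (eqP sigma1) addrr_pchar2 // scale0r.
Qed.

(** Both terms remain in degree [l + m - 1]; they are multiples of the same tensor, with factors
    [1 + rho] and [1 + sigma], and these add up to [rho + sigma]. *)
Lemma loewy_eq_bands_eq : orth l.-1 m -> orth l m.-1 ->
  loewy_eq X Y (if (rho == 1%R) && (sigma == 1%R) then (sharp l.-1 m.-1).+1
                else if rho == sigma then l + m - 1 else l + m)%N.
Proof.
move=> o1 o2; have no : ~~ orth l m by rewrite orth_pred // o1 o2.
have SX : S ^+ (l + m - 1) * X = (rho + sigma) *: t (alt_word y1 x1 l)
  (alt_word y2 x2 m).
  rewrite expand_pred_mulx // o1 o2 !mulr1n apx bpx alE bmE (tensZl tP) (tensZr tP).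
  by rewrite -scalerDl addrACA addrr_pchar2 // add0r.
case: ifPn => [/andP[/eqP rho1 /eqP sigma1]|ne1].
  split=> [|i]; last exact: bands_lower.
  apply: (loewy_le_sharp k_char2 tP) => //;
    rewrite prednK // ?alE ?bmE ?rho1 ?sigma1;
    by rewrite addrr_pchar2 // scale0r.
have S0 : S ^+ (l + m - 1).+1 = 0.
  have -> : ((l + m - 1).+1 = l + m)%N by lia.
  by rewrite expand_top (negPf no).
case: ifPn => [/eqP rho_sigma|ne]; last first.
  split=> [|i le_i]; first exact: loewy_le_top.
  rewrite leqNgt; apply: contraT; rewrite negbK => /loewy_le_pred/(_ le_i)/eqP.
  by rewrite SX scaler_eq0 add_eq0 (negPf ne) (negPf (tens_neq0 tP Bl Bm)).
split=> [|i /loewy_le_tensor[_ Si]].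
  by apply/loewy_le_tensor; rewrite SX rho_sigma addrr_pchar2 // scale0r.
rewrite leqNgt; apply/negP => lt_i.
have ne2 : sigma != 1 by move: ne1; rewrite rho_sigma andbb.
(* For [rho = sigma != 1] the product with X vanishes in this degree, but the bidegree [(l, m - 1)]
   shows that the power of [S] itself does not. *)
have : S ^+ (l + m.-1) * t 1 1 != 0.
  apply: (@expand_neq0 _ k_char2 _ _ _ _ tP a 1 b 1 l m);
    rewrite ?mulr1 ?leq_pred //.
    by rewrite alE scaler_eq0 add1_eq0 rho_sigma (negPf ne2) (negPf Bl).
  by rewrite bmE scaler_eq0 add1_eq0 (negPf ne2) (negPf Bm).
have /subnK <- : (i.+1 <= l + m.-1)%N by lia.
by rewrite exprD Si mulr0 mul0r eqxx.
Qed.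

End Bands.
End TensorLoewy.

(** * Kronecker products and annihilators *)

Section Tprod.

Variable k : fieldType.

Lemma trow_entry n1 m2 n2 (A : 'rV[k]_n1) (B : 'M_(m2, n2))
    (i' : 'I_n1) (j' : 'I_n2) (x : 'I_m2) (y : 'I_(n1 * n2)) :
  y = (i' * n2 + j')%N :> nat -> trow A B x y = A 0 i' * B x j'.
Proof.
elim: n1 A i' y => [|n1 IH] A i' y; first by case: i'.
have lt_j := ltn_ord j'; move: y; rewrite /= => y Ey; rewrite mxE.
case: (splitP y) => y1 Ey1; have {Ey1}Ey := etrans (esym Ey) Ey1.
  have i0 : i' = 0.
    apply/val_inj => /=; have [//|i_gt0] := posnP i'.
    by have := leq_pmull n2 i_gt0; have := ltn_ord y1; lia.
  have -> : y1 = j' by apply/val_inj; move: Ey; rewrite i0 /=; lia.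
  by rewrite !mxE i0; congr (A _ _ * _); apply/val_inj.
have i_gt0 : (0 < i')%N.
  by have [i0|//] := posnP i'; rewrite i0 mul0n in Ey; lia.
have lt_i : (i'.-1 < n1)%N by have := ltn_ord i'; lia.
rewrite (IH _ (Ordinal lt_i)) /=; last first.
  apply: (@addnI n2); apply: etrans (esym Ey) _.
  by rewrite -subn1 mulnBl mul1n; have := leq_pmull n2 i_gt0; lia.
by rewrite !mxE; congr (A _ _ * _); apply/val_inj => /=; lia.
Qed.

Lemma tprod_entry m1 n1 m2 n2 (A : 'M[k]_(m1, n1)) (B : 'M_(m2, n2))
    (i : 'I_m1) (j : 'I_m2) (i' : 'I_n1) (j' : 'I_n2)
    (x : 'I_(m1 * m2)) (y : 'I_(n1 * n2)) :
  x = (i * m2 + j)%N :> nat -> y = (i' * n2 + j')%N :> nat ->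
  tprod A B x y = A i i' * B j j'.
Proof.
elim: m1 A i x => [|m1 IH] A i x; first by case: i.
have lt_j := ltn_ord j; move: x; rewrite /= => x Ex Ey; rewrite mxE.
case: (splitP x) => x1 Ex1; have {Ex1}Ex := etrans (esym Ex) Ex1.
  have i0 : i = 0.
    apply/val_inj => /=; have [//|i_gt0] := posnP i.
    by have := leq_pmull m2 i_gt0; have := ltn_ord x1; lia.
  have -> : x1 = j by apply/val_inj; move: Ex; rewrite i0 /=; lia.
  rewrite (@trow_entry _ _ _ _ _ i' j') // !mxE i0; congr (A _ _ * _).
  by apply/val_inj.
have i_gt0 : (0 < i)%N.
  by have [i0|//] := posnP i; rewrite i0 mul0n in Ex; lia.
have lt_i : (i.-1 < m1)%N by have := ltn_ord i; lia.
rewrite (IH _ (Ordinal lt_i)) //=; last first.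
  apply: (@addnI m2); apply: etrans (esym Ex) _.
  by rewrite -subn1 mulnBl mul1n; have := leq_pmull m2 i_gt0; lia.
by rewrite !mxE; congr (A _ _ * _); apply/val_inj => /=; lia.
Qed.

Lemma tprod_idx m1 m2 (x : 'I_(m1 * m2)) :
  exists (i : 'I_m1) (j : 'I_m2), x = (i * m2 + j)%N :> nat.
Proof.
have m2_gt0 : (0 < m2)%N by case: m2 x => //; rewrite muln0 => -[].
have lt_i : (x %/ m2 < m1)%N by rewrite ltn_divLR.
have lt_j : (x %% m2 < m2)%N by rewrite ltn_mod.
by exists (Ordinal lt_i), (Ordinal lt_j); rewrite /= -divn_eq.
Qed.

Lemma tprod_idxP m1 m2 (i : 'I_m1) (j : 'I_m2) :
  exists x : 'I_(m1 * m2), x = (i * m2 + j)%N :> nat.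
Proof.
have lt_x : (i * m2 + j < m1 * m2)%N.
  by have := leq_mul (ltn_ord i) (leqnn m2); have := ltn_ord j; rewrite mulSn; lia.
by exists (Ordinal lt_x).
Qed.

Lemma tprod_tensor_like d1 d2 :
  tensor_like (fun (A : 'M[k]_d1) (B : 'M[k]_d2) => tprod A B).
Proof.
split=> [A A' B|A B B'|c A B|c A B|A A' B B'||A B].
- apply/matrixP => x y; have [i [j Ex]] := tprod_idx x;
  have [i' [j' Ey]] := tprod_idx y.
  by rewrite !mxE !(tprod_entry _ _ Ex Ey) mxE mulrDl.
- apply/matrixP => x y; have [i [j Ex]] := tprod_idx x;
  have [i' [j' Ey]] := tprod_idx y.
  by rewrite !mxE !(tprod_entry _ _ Ex Ey) mxE mulrDr.
- apply/matrixP => x y; have [i [j Ex]] := tprod_idx x;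
  have [i' [j' Ey]] := tprod_idx y.
  by rewrite !mxE !(tprod_entry _ _ Ex Ey) mxE mulrA.
- apply/matrixP => x y; have [i [j Ex]] := tprod_idx x;
  have [i' [j' Ey]] := tprod_idx y.
  by rewrite !mxE !(tprod_entry _ _ Ex Ey) mxE mulrCA.
- exact: tprodE.
- exact: tprod1.
move=> /matrix0Pn[i [i' Ai]] /matrix0Pn[j [j' Bj]].
have [x Ex] := tprod_idxP i j; have [y Ey] := tprod_idxP i' j'.
apply/matrix0Pn; exists x, y.
by rewrite (tprod_entry _ _ Ex Ey) mulf_neq0.
Qed.

End Tprod.

Section Annihilator.

Variables (k : fieldType) (k_char2 : 2%N \in [pchar k]).
Local Notation addxx := (@mx_addxx _ k_char2 _).

(** The shifted index of the B-words counts the empty word only once. *)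
Definition word_comb d (x y : 'M[k]_d) n (u v : nat -> k) : 'M[k]_d :=
  \sum_(i < n) (u i *: alt_word x y i + v i *: alt_word y x i.+1).

Definition same_ann d1 d1' (x y : 'M[k]_d1) (x' y' : 'M[k]_d1') : Prop :=
  forall n u v, word_comb x y n u v = 0 <-> word_comb x' y' n u v = 0.

Variables (d1 d1' d2 : nat) (x y : 'M[k]_d1) (x' y' : 'M[k]_d1').
Variables (x2 y2 : 'M[k]_d2).
Hypotheses (xx : x * x = 0) (yy : y * y = 0).
Hypotheses (xx' : x' * x' = 0) (yy' : y' * y' = 0).

Definition tensor_comb d (x y : 'M[k]_d) n (P Q : nat -> 'M[k]_d2) :=
  \sum_(i < n) (tprod (alt_word x y i) (P i) + tprod (alt_word y x i.+1) (Q i)).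

(** The entries of the second factor serve as scalar coefficients, so a relation in the tensor
    product becomes a family of relations in the first factor. *)
Lemma tensor_comb_eq0 d (z w : 'M[k]_d) n P Q : tensor_comb z w n P Q = 0 <->
  forall j j', word_comb z w n (fun i => P i j j') (fun i => Q i j j') = 0.
Proof.
split=> [H j j'|H].
  apply/matrixP => i i'; have [r Er] := tprod_idxP i j;
    have [s Es] := tprod_idxP i' j'.
  have := congr1 (fun M : 'M_(_, _) => M r s) H; rewrite !mxE !summxE => E.
  rewrite -[RHS]E; apply: eq_bigr => a _.
  move: (alt_word z w a) (alt_word w z a.+1) => U V.
  by rewrite !mxE !(tprod_entry _ _ Er Es) [P a j j' * _]mulrC [Q a j j' * _]mulrC.
apply/matrixP => r s; have [i [j Er]] := tprod_idx r;
  have [i' [j' Es]] := tprod_idx s.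
have := congr1 (fun M : 'M_(_, _) => M i i') (H j j'); rewrite !mxE !summxE => E.
rewrite -[RHS]E; apply: eq_bigr => a _.
move: (alt_word z w a) (alt_word w z a.+1) => U V.
by rewrite !mxE !(tprod_entry _ _ Er Es) [P a j j' * _]mulrC [Q a j j' * _]mulrC.
Qed.

Lemma alt_word_step d (z w : 'M[k]_d) n : z * z = 0 -> w * w = 0 ->
  z * alt_word z w n.+1 = (if odd n.+1 then alt_word z w n.+2 else 0) /\
  w * alt_word z w n.+1 = (if odd n.+1 then 0 else alt_word z w n.+2).
Proof.
by move=> zz ww /=; case: odd => /=; rewrite !mulrA ?zz ?ww ?mul0r.
Qed.

(** Operators given by the same formal expression over the two first factors. As a relation it is
    visibly closed under sums, and [matched_mul] adds both generators, without carrying coefficient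
    families along. *)
Inductive matched : 'M[k]_(d1 * d2) -> 'M[k]_(d1' * d2) -> Prop :=
| MatchedA n P : matched (tprod (alt_word x y n) P) (tprod (alt_word x' y' n) P)
| MatchedB n P : matched (tprod (alt_word y x n.+1) P) (tprod (alt_word y' x'
  n.+1) P)
| MatchedD T U T' U' of matched T T' & matched U U' : matched (T + U) (T' + U').

Let tp d := @tprod_tensor_like k d d2.

Lemma matched0 : matched 0 0.
Proof. by have := MatchedA 0 0; rewrite !(tens0r (tp _)). Qed.

Lemma tens_genE d (z a : 'M[k]_d) (z2 P : 'M[k]_d2) :
  (1 + tprod (1 + z) (1 + z2)) * tprod a P =
  tprod (z * a) ((1 + z2) * P) + tprod a (z2 * P).
Proof.
rewrite mulr1Dl -(tensM (tp d)) !mulr1Dl (tensDl (tp d)) [tprod a (P +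
  _)](tensDr (tp d)).
by rewrite !addrA addxx add0r addrC.
Qed.

Lemma matched_mul T T' : matched T T' ->
  matched ((1 + tprod (1 + x) (1 + x2)) * T) ((1 + tprod (1 + x') (1 + x2)) * T') /\
  matched ((1 + tprod (1 + y) (1 + y2)) * T) ((1 + tprod (1 + y') (1 + y2)) * T').
Proof.
elim=> {T T'} [n P|n P|T U T' U' _ [IH1 IH2] _ [IH3 IH4]]; last first.
- by rewrite !mulrDr; split; apply: MatchedD.
- rewrite !tens_genE; have [-> ->] := alt_word_step n yy xx;
  have [-> ->] := alt_word_step n yy' xx'.
  by split; apply: MatchedD; try exact: MatchedB; case: ifP => _;
    rewrite ?(tens0l (tp _)); [exact: matched0 | exact: MatchedB
                              | exact: MatchedB | exact: matched0].
rewrite !tens_genE; split; apply: MatchedD; try exact: MatchedA; case: n => [|n].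
- by rewrite /= !mulr1; have := MatchedB 0 ((1 + x2) * P); rewrite /= !mulr1.
- have [-> _] := alt_word_step n xx yy; have [-> _] := alt_word_step n xx' yy'.
  by case: ifP => _; rewrite ?(tens0l (tp _)); [exact: MatchedA | exact: matched0].
- by rewrite /= !mulr1; have := MatchedA 1 ((1 + y2) * P); rewrite /= !mulr1.
have [_ ->] := alt_word_step n xx yy; have [_ ->] := alt_word_step n xx' yy'.
by case: ifP => _; rewrite ?(tens0l (tp _)); [exact: matched0 | exact: MatchedA].
Qed.

Lemma tensor_comb_widen d (z w : 'M[k]_d) m n P Q :
  (forall i, (m <= i)%N -> P i = 0 /\ Q i = 0) ->
  tensor_comb z w (m + n) P Q = tensor_comb z w m P Q.
Proof.
move=> PQ0; rewrite /tensor_comb big_split_ord /= [X in _ + X]big1 ?addr0 // => i _.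
by have [-> ->] := PQ0 (m + i)%N (leq_addr _ _); rewrite !(tens0r (tp _)) addr0.
Qed.

Lemma matched_comb T T' : matched T T' -> exists n P Q,
  [/\ forall i, (n <= i)%N -> P i = 0 /\ Q i = 0,
      T = tensor_comb x y n P Q & T' = tensor_comb x' y' n P Q].
Proof.
have single d (F : nat -> 'M[k]_d) n (P : 'M[k]_d2) :
    \sum_(i < n.+1) tprod (F i) (if i == n :> nat then P else 0) = tprod (F n) P.
  rewrite big_ord_recr /= eqxx big1 ?add0r // => i _.
  by rewrite ltn_eqF ?ltn_ord //= (tens0r (tp _)).
elim=> {T T'} [n P|n P|T U T' U' _ [n [P [Q [PQ0 -> ->]]]] _ [m [P' [Q' [PQ0'
  -> ->]]]]].
- exists n.+1, (fun i => if i == n then P else 0), (fun=> 0).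
  by split=> [i lt_ni||]; rewrite ?gtn_eqF // /tensor_comb -single;
    apply: eq_bigr => i _; rewrite (tens0r (tp _)) addr0.
- exists n.+1, (fun=> 0), (fun i => if i == n then P else 0).
  by split=> [i lt_ni||];
    rewrite ?gtn_eqF // /tensor_comb -(single _ (fun i => alt_word _ _ i.+1));
    apply: eq_bigr => i _; rewrite (tens0r (tp _)) add0r.
exists (n + m)%N, (fun i => P i + P' i), (fun i => Q i + Q' i).
have D d (z w : 'M[k]_d) : tensor_comb z w n P Q + tensor_comb z w m P' Q' =
    tensor_comb z w (n + m) (fun i => P i + P' i) (fun i => Q i + Q' i).
  rewrite -(tensor_comb_widen _ _ m PQ0) -(tensor_comb_widen _ _ n PQ0') addnC.
  rewrite /tensor_comb -big_split; apply: eq_bigr => i _ /=.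
  by rewrite !(tensDr (tp _)) addrACA.
split=> [i le_i||]; [|exact: D|exact: D].
have [|-> ->] := PQ0 i; first lia.
by have [|-> ->] := PQ0' i; [lia | rewrite !addr0].
Qed.

Lemma loewy_le_same_ann n : same_ann x y x' y' ->
  loewy_le (1 + tprod (1 + x) (1 + x2)) (1 + tprod (1 + y) (1 + y2)) n <->
  loewy_le (1 + tprod (1 + x') (1 + x2)) (1 + tprod (1 + y') (1 + y2)) n.
Proof.
move=> ann; set X := 1 + tprod _ _; set Y := 1 + tprod _ _.
set X' := 1 + tprod _ _; set Y' := 1 + tprod _ _.
have one : matched 1 1.
  by have := MatchedA 0 1; rewrite /= !(tens1 (tp _)).
have M i : matched (alt_word X Y i) (alt_word X' Y' i) /\ matched (alt_word Y X
  i) (alt_word Y' X' i).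
  elim: i => [|i [IH1 IH2]]; first by split; exact: one.
  by split=> /=; case: odd; apply: (matched_mul _).1 || apply: (matched_mul _).2.
have E T T' : matched T T' -> T = 0 <-> T' = 0.
  case/matched_comb=> [r [P [Q [_ -> ->]]]]; rewrite !tensor_comb_eq0.
  by split=> H j j'; apply/ann/H.
by split=> -[H1 H2]; split;
  first [apply/(E _ _ (M n.+1).1) | apply/(E _ _ (M n.+1).2)].
Qed.

End Annihilator.

(** * String and band modules *)

(* v i = A_i e and u i = B_i e for a generator e of the module. *)
Record two_armed (k : fieldType) d (x y : 'M[k]_d) (v u : nat -> 'cV[k]_d) : Prop :=
  TwoArmed {
    arm0 : v 0%N = u 0%N;
    arm_yv : forall i, y *m v i = if odd i then 0 else v i.+1;
    arm_xv : forall i, x *m v i.+1 = if odd i.+1 then v i.+2 else 0;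
    arm_xu : forall i, x *m u i = if odd i then 0 else u i.+1;
    arm_yu : forall i, y *m u i.+1 = if odd i.+1 then u i.+2 else 0;
    arm_span : forall P : 'M[k]_d,
      (forall i, P *m v i = 0) -> (forall i, P *m u i = 0) -> P = 0 }.

Lemma two_armedC (k : fieldType) d (x y : 'M[k]_d) v u :
  two_armed x y v u -> two_armed y x u v.
Proof. by case=> *; split=> // P Pu Pv;
  match goal with H : _ |- _ => exact: H end. Qed.

Section TwoArmed.

Variables (k : fieldType) (d : nat).
Implicit Types (x y : 'M[k]_d) (v u : nat -> 'cV[k]_d).

(** The word acts with its last letter [y] first, and [y] is the letter that moves [v i] outwards
    when [i] is even. *)
Lemma alt_word_arm_even x y v u n i : two_armed x y v u -> ~~ odd i -> alt_word
  x y n *m v i = v (i + n)%N.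
Proof.
move=> M ev_i; elim: n => [|n IHn]; first by rewrite addn0; exact: mul1mx.
rewrite /= -mulmxA IHn; have := arm_yv M (i + n); have := oddD i n.
rewrite (negPf ev_i) addFb addnS => ->; case: (boolP (odd n)) => // on _.
by case: n on {IHn} => // n on; have := arm_xv M (i + n)%N;
  rewrite -!addnS oddD (negPf ev_i) on.
Qed.

Lemma alt_word_arm_odd x y v u n i : two_armed x y v u -> odd i -> alt_word y x
  n *m v i = v (i + n)%N.
Proof.
move=> M; case: i => // i od_i; elim: n => [|n IHn]; first by rewrite addn0;
  exact: mul1mx.
rewrite /= -mulmxA IHn !addSn addnS; have := arm_yv M (i.+1 + n);
  have := arm_xv M (i + n).
rewrite -!addSn oddD od_i addTb if_neg; case: (odd n) => /= [_|] //;
  by rewrite addSn.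
Qed.

Lemma alt_word_arm_even0 x y v u n i : two_armed x y v u -> ~~ odd i -> (0 < i)%N ->
  alt_word y x n.+1 *m v i = 0.
Proof.
move=> M; case: i => // i ev_i _;
  rewrite alt_word_rcons -[alt_word _ _ _ * x]/(_ *m x) -mulmxA.
by rewrite (arm_xv M) (negPf ev_i) mulmx0.
Qed.

Lemma alt_word_arm_odd0 x y v u n i : two_armed x y v u -> odd i -> alt_word x
  y n.+1 *m v i = 0.
Proof.
move=> M od_i; rewrite alt_word_rcons -[alt_word _ _ _ * y]/(_ *m y) -mulmxA.
by rewrite (arm_yv M) od_i mulmx0.
Qed.

Lemma two_armed_sqr0 x y v u : two_armed x y v u -> x * x = 0.
Proof.
move=> M; apply: (arm_span M) => -[|i]; rewrite -[x * x]/(x *m x) -mulmxA.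
- by rewrite (arm0 M) (arm_xu M) (arm_xu M).
- rewrite (arm_xv M); case: ifP => od_i; last exact: mulmx0.
  by rewrite (arm_xv M) oddS od_i.
- by rewrite (arm_xu M) (arm_xu M).
rewrite (arm_xu M); case: ifP => od_i; first exact: mulmx0.
by rewrite (arm_xu M) oddS od_i.
Qed.

Lemma alt_word_eq0 x y v u n : two_armed x y v u -> (0 < n)%N ->
  v n = 0 -> (forall i, (n < i)%N -> v i = 0 /\ u i = 0) -> alt_word x y n = 0.
Proof.
case: n => // n M _ vn vu0; apply: (arm_span M) => i.
  have [od_i|ev_i] := boolP (odd i); first exact: (alt_word_arm_odd0 _ M).
  rewrite (alt_word_arm_even _ M) //; case: i {ev_i} => [|i] //.
  by have [] := vu0 (i.+1 + n.+1)%N ltac:(lia).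
have M' := two_armedC M; have [od_i|ev_i] := boolP (odd i).
  rewrite (alt_word_arm_odd _ M') //; case: i od_i => // i _.
  by have [] := vu0 (i.+1 + n.+1)%N ltac:(lia).
case: i ev_i => [_|i ev_i]; last exact: (alt_word_arm_even0 _ M').
by rewrite -(arm0 M) (alt_word_arm_even _ M).
Qed.

Lemma two_armed_loewy x y v u n : two_armed x y v u ->
  (forall i, (n < i)%N -> v i = 0 /\ u i = 0) -> loewy_le x y n.
Proof.
move=> M vu0; split.
  apply: (alt_word_eq0 M) => // [|i lt_i]; first by have [] := vu0 n.+1 (ltnSn n).
  exact/vu0/ltnW.
apply: (alt_word_eq0 (two_armedC M)) => // [|i lt_i];
  first by have [] := vu0 n.+1 (ltnSn n).
by have [-> ->] := vu0 i (ltnW lt_i).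
Qed.

Lemma two_armed_wd_neq0 x y v u n : two_armed x y v u -> v n != 0 -> alt_word x
  y n != 0.
Proof. by move=> M; rewrite -[n]add0n -(alt_word_arm_even n M) //;
  apply: contraNneq => ->; rewrite mul0mx. Qed.

Section Longer.

Variables (x y : 'M[k]_d) (v u : nat -> 'cV[k]_d) (l : nat).
Hypotheses (M : two_armed x y v u) (l_gt0 : (0 < l)%N).
Hypotheses (vl : v l != 0) (v0 : forall i, (l < i)%N -> v i = 0).

Lemma arm_free n (c : nat -> k) : \sum_(i < n) c i *: v i.+1 = 0 ->
  forall i, (i < n)%N -> (i < l)%N -> c i = 0.
Proof.
move=> sum0; elim/ltn_ind=> i IHi lt_in lt_il.
(* [W] pushes [v i.+1] to the end [v l] of the arm and kills all later arm vectors, so the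
   coefficients vanish one after another. *)
pose W := if odd i.+1 then alt_word y x (l - i.+1) else alt_word x y (l - i.+1).
have Wi : W *m v i.+1 = v l.
  rewrite /W; case: ifPn => [od_i|ev_i].
    by rewrite (alt_word_arm_odd _ M) // subnKC.
  by rewrite (alt_word_arm_even _ M) // subnKC.
have Wr r : (i < r)%N -> W *m v r.+1 = 0.
  move=> lt_ir; have v0' : v (r.+1 + (l - i.+1))%N = 0 by apply: v0; lia.
  have [E|E] := boolP (odd r.+1); rewrite /W; case: ifP => _.
  - by rewrite (alt_word_arm_odd _ M).
  - case: (l - i.+1)%N v0' => [|s] v0'; last exact: (alt_word_arm_odd0 _ M).
    by rewrite mul1mx -[r.+1]addn0.
  - case: (l - i.+1)%N v0' => [|s] v0'; last exact: (alt_word_arm_even0 _ M).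
    by rewrite mul1mx -[r.+1]addn0.
  - by rewrite (alt_word_arm_even _ M).
have := congr1 (mulmx W) sum0;
  rewrite mulmx0 mulmx_sumr (bigD1 (Ordinal lt_in)) //=.
rewrite big1 => [|r]; last first.
  rewrite -val_eqE /= -scalemxAr => ne_ri.
  have [lt_ri|lt_ir|//] := ltngtP r i; last by rewrite eq_sym in ne_ri; lia.
    by rewrite IHi ?scale0r //; lia.
  by rewrite Wr ?scaler0.
by rewrite addr0 -scalemxAr Wi => /eqP; rewrite scaler_eq0 (negPf vl) orbF => /eqP.
Qed.

Hypothesis u0 : forall i, (l <= i)%N -> u i = 0.

(** The strictly longer arm decides alone: A-words up to length [l] and B-words shorter than [l] are
    independent, all others vanish. So the annihilator sees neither the shorter arm nor the band
    parameter. *)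
Lemma word_comb_eq0 n a b : word_comb x y n a b = 0 <->
  (forall i, (i < n)%N -> (i <= l)%N -> a i = 0) /\
  (forall i, (i < n)%N -> (i.+1 < l)%N -> b i = 0).
Proof.
have M' := two_armedC M; split=> [|[a0 b0]]; last first.
  rewrite /word_comb big1 // => i _.
  have -> : a i *: alt_word x y i = 0.
    have [le_il|lt_li] := leqP i l; first by rewrite a0 ?scale0r.
    rewrite (alt_word_eq0 M) ?scaler0 ?v0 //; first lia.
    by move=> j lt_ij; rewrite v0 ?u0 //; lia.
  have [lt_il|le_li] := ltnP i.+1 l; first by rewrite b0 ?scale0r ?addr0.
  rewrite (alt_word_eq0 M') ?scaler0 ?addr0 ?u0 //.
  by move=> j lt_ij; rewrite v0 ?u0 //; lia.
case: n => [|n] E; first by split.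
(* On [v 1] the nonempty A-words vanish and the B-words shift along the arm, which isolates [a 0]
   and the [b i]. *)
have ab0 : forall i, (i < n.+2)%N -> (i < l)%N -> (if i is i'.+1 then b i' else
  a 0%N) = 0.
  apply: arm_free; rewrite big_ord_recl /= -[RHS](mul0mx _ (v 1%N)) -E.
  rewrite /word_comb big_split mulmxDl; congr (_ + _).
    rewrite big_ord_recl mulmxDl -scalemxAl mul1mx mulmx_suml big1 ?addr0 // => i _.
    by rewrite -scalemxAl (alt_word_arm_odd0 _ M) // scaler0.
  rewrite mulmx_suml; apply: eq_bigr => i _.
  by rewrite -scalemxAl (alt_word_arm_odd _ M).
have b0 i : (i < n.+1)%N -> (i.+1 < l)%N -> b i = 0 by move=> ? ?;
  exact: (ab0 i.+1).
split=> // -[|i] lt_in lt_il; first exact: (ab0 0%N).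
apply: (@arm_free n (fun i => a i.+1)); try lia.
have a00 : a 0%N = 0 by exact: (ab0 0%N).
rewrite -[RHS](mul0mx _ (v 0%N)) -E /word_comb mulmx_suml big_ord_recl.
rewrite mulmxDl -!scalemxAl mul1mx a00 scale0r add0r.
(* On [v 0 = u 0] the B-words run along the other arm: from length [l] on they give zero, and the
   shorter ones have zero coefficient by now. *)
have bu j : (j < n.+1)%N -> b j *: (alt_word y x j.+1 *m v 0%N) = 0.
  move=> lt_jn; have [lt_jl|le_lj] := ltnP j.+1 l; first by rewrite b0 ?scale0r.
  by rewrite (arm0 M) (alt_word_arm_even _ M') // u0 ?scaler0.
rewrite (bu 0%N) // add0r; apply: eq_bigr => j _.
rewrite mulmxDl -!scalemxAl [X in _ = _ + X]bu ?addr0;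
  last exact: (ltn_ord (lift ord0 j)).
by rewrite (alt_word_arm_even _ M).
Qed.

End Longer.
End TwoArmed.

Lemma size_AB t : size (A_ t) = t /\ size (B_ t) = t.
Proof. by elim: t => // t [IHA IHB];
  rewrite /A_ /B_ /= !size_rcons -/(A_ t) -/(B_ t) IHA IHB. Qed.

Lemma size_A t : size (A_ t) = t. Proof. exact: (size_AB t).1. Qed.
Lemma size_B t : size (B_ t) = t. Proof. exact: (size_AB t).2. Qed.

Lemma nth_AB d t i : (i < t)%N ->
  nth d (A_ t) i = (if odd (t - i) then Y else X, false) /\
  nth d (B_ t) i = (if odd (t - i) then X else Y, false).
Proof.
elim: t => // t IH; rewrite ltnS => le_it.
have -> : A_ t.+1 = rcons (B_ t) (Y, false) by [].
have -> : B_ t.+1 = rcons (A_ t) (X, false) by [].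
rewrite !nth_rcons size_A size_B subSn // oddS.
move: le_it; rewrite leq_eqVlt => /predU1P[->|lt_it].
  by rewrite ltnn eqxx subnn.
by rewrite lt_it; have [-> ->] := IH lt_it; case: odd.
Qed.

(* w = A_l1 B_l2^-1, read with zx, zy in the roles of X, Y *)
Definition two_armed_word (w : word) (l1 l2 : nat) (zx zy : gen) : Prop :=
  [/\ zx != zy, size w = (l1 + l2)%N,
      forall d i, (i < l1)%N -> nth d w i = (if odd (l1 - i) then zy else zx, false)
    & forall d i, (l1 <= i)%N -> (i < l1 + l2)%N ->
        nth d w i = (if odd (i - l1) then zy else zx, true)].

Lemma two_armed_word_A l : two_armed_word (A_ l) l 0 X Y.
Proof.
split=> // [|d i lt_i|d i le_i]; first by rewrite size_A addn0.
  by have [-> _] := nth_AB d lt_i.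
by rewrite addn0 ltnNge le_i.
Qed.

Lemma two_armed_word_B l : two_armed_word (B_ l) l 0 Y X.
Proof.
split=> // [|d i lt_i|d i le_i]; first by rewrite size_B addn0.
  by have [_ ->] := nth_AB d lt_i.
by rewrite addn0 ltnNge le_i.
Qed.

Lemma two_armed_word_AB l1 l2 : two_armed_word (A_ l1 ++ word_inv (B_ l2)) l1
  l2 X Y.
Proof.
have sz : size (word_inv (B_ l2)) = l2 by rewrite size_rev size_map size_B.
split=> // [|d i lt_i|d i le_i lt_i]; first by rewrite size_cat sz size_A.
  by rewrite nth_cat size_A lt_i; have [->] := nth_AB d lt_i.
rewrite nth_cat size_A ltnNge le_i /= nth_rev ?size_map ?size_B; last lia.
have lt_j : (l2 - (i - l1).+1 < l2)%N by lia.
rewrite (nth_map d) ?size_B //; have [_ ->] := nth_AB d lt_j.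
have -> : (l2 - (l2 - (i - l1).+1) = (i - l1).+1)%N by lia.
by rewrite /=; case: odd.
Qed.

(** * The arms of string and band modules in coordinates *)

Section Columns.

Variable k : fieldType.

Definition ecol d (i : nat) : 'cV[k]_d := \col_j (j == i :> nat)%:R.

Lemma mulmx_ecol d (M : 'M[k]_d) (i : 'I_d) : M *m ecol d i = col i M.
Proof.
apply/colP => j; rewrite !mxE (bigD1 i) //= big1 => [|r ne_ri].
  by rewrite !mxE eqxx mulr1 addr0.
by rewrite !mxE -val_eqE /= in ne_ri *; rewrite (negPf ne_ri) mulr0.
Qed.

Lemma ecol_neq0 d i : (i < d)%N -> ecol d i != 0.
Proof.
move=> lt_id; apply/matrix0Pn; exists (Ordinal lt_id), 0.
by rewrite mxE eqxx oner_eq0.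
Qed.

Lemma ecol_span d (P : 'M[k]_d) : (forall i, (i < d)%N -> P *m ecol d i = 0) ->
  P = 0.
Proof.
move=> H; apply/matrixP => i j; rewrite mxE.
by have := H j (ltn_ord j); rewrite mulmx_ecol => /colP/(_ i); rewrite !mxE.
Qed.

Section Word.

Variables (w : word) (l1 l2 : nat) (zx zy : gen).
Hypothesis wP : two_armed_word w l1 l2 zx zy.

Let sz : size w = (l1 + l2)%N. Proof. by case: wP. Qed.

Let nth_l d j : (j < l1)%N ->
  nth d w (l1 - j).-1 = (if odd j then zx else zy, false).
Proof.
case: wP => _ _ nl _ lt_j; rewrite nl; last lia.
have -> : (l1 - (l1 - j).-1 = j.+1)%N by lia. by rewrite oddS; case: odd.
Qed.

Let nth_r d j : (j < l2)%N -> nth d w (l1 + j) = (if odd j then zy else zx, true).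
Proof. by case: wP => _ _ _ nr lt_j; rewrite nr ?addKn //; lia. Qed.

Let flag d i : (i < l1 + l2)%N -> (nth d w i).2 = (l1 <= i)%N.
Proof.
case: wP => _ _ nl nr lt_i; have [le_li|lt_il] := leqP l1 i; first by rewrite nr.
by rewrite nl.
Qed.

Let zxy : (zx == zy) = false. Proof. by apply/negbTE; case: wP. Qed.
Let zyx : (zy == zx) = false. Proof. by rewrite eq_sym zxy. Qed.

(** The generator is [e_(l1)], where direct letters meet inverse ones; this arm descends to [e_0],
    the other ascends to [e_(l1 + l2)]. *)
Definition string_v i := if (i <= l1)%N then ecol (size w).+1 (l1 - i) else 0.
Definition string_u i := if (i <= l2)%N then ecol (size w).+1 (l1 + i) else 0.

Lemma string_ev z i : (i <= size w)%N -> string_mx k w z *m ecol _ i =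
  if (0 < i)%N && (lett w i == (z, false)) then ecol _ i.-1
  else if (i < size w)%N && (lett w i.+1 == (z, true)) then ecol _ i.+1 else 0.
Proof.
rewrite -ltnS => lt_i; rewrite (mulmx_ecol _ (Ordinal lt_i)); apply/colP => j.
by rewrite !mxE /=; case: ifP => _; [|case: ifP => _]; rewrite mxE.
Qed.

Lemma string_ev_l z j : (0 < j)%N -> (j <= l1)%N -> string_mx k w z *m string_v j =
  if z == (if odd j then zx else zy) then string_v j.+1 else 0.
Proof.
move=> j_gt0 le_j; rewrite /string_v le_j string_ev; last by rewrite sz; lia.
have -> : (lett w (l1 - j).+1 == (z, true)) = false.
  apply/negbTE/eqP => /(congr1 snd) /=; rewrite /lett /= flag; lia.
rewrite andbF; have [lt_j|ge_j] := ltnP j l1; last first.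
  have -> : (0 < l1 - j)%N = false by lia.
  by rewrite andFb; case: eqP.
have -> : (0 < l1 - j)%N by lia.
rewrite /lett nth_l // xpair_eqE eqxx andbT andTb eq_sym; case: eqP => // _.
by congr ecol; lia.
Qed.

Lemma string_ev_r z j : (0 < j)%N -> (j <= l2)%N -> string_mx k w z *m string_u j =
  if z == (if odd j then zy else zx) then string_u j.+1 else 0.
Proof.
move=> j_gt0 le_j; rewrite /string_u le_j string_ev; last by rewrite sz; lia.
have -> : (lett w (l1 + j) == (z, false)) = false.
  apply/negbTE/eqP => /(congr1 snd) /=; rewrite /lett /= flag; lia.
rewrite andbF sz ltn_add2l; have [lt_j|ge_j] := ltnP j l2; last by rewrite if_same.
rewrite /lett nth_r // xpair_eqE eqxx andbT andTb eq_sym; case: eqP => // _.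
by rewrite addnS.
Qed.

Lemma string_ev0 z : string_mx k w z *m ecol _ l1 =
  if z == zy then string_v 1 else string_u 1.
Proof.
rewrite string_ev; last by rewrite sz; lia.
have El : (0 < l1)%N -> lett w l1 = (zy, false).
  by move=> l_gt0; have := nth_l (X, false) l_gt0; rewrite subn0 /lett => ->.
have Er : (0 < l2)%N -> lett w l1.+1 = (zx, true).
  move=> l_gt0; have := nth_r (X, false) l_gt0. by rewrite addn0 /lett => ->.
have -> : (l1 < size w)%N = (0 < l2)%N by rewrite sz; lia.
rewrite /string_v /string_u.
have Hz : (z == zx) = ~~ (z == zy).
  by move: zxy; clear; case: z; case: zx; case: zy.
case: (posnP l1) => [l10|l_gt0]; case: (posnP l2) => [l20|l2_gt0] /=;
  rewrite ?El ?Er // ?xpair_eqE ?eqxx ?andbT ?(eq_sym zy z) ?(eq_sym zx z) ?Hz;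
  case: eqP => //= _; rewrite ?subn1 ?addn1 //.
Qed.

Lemma string_two_armed :
  two_armed (string_mx k w zx) (string_mx k w zy) string_v string_u.
Proof.
have v0 i : (l1 < i)%N -> string_v i = 0 by rewrite /string_v ltnNge => /negbTE->.
have u0 i : (l2 < i)%N -> string_u i = 0 by rewrite /string_u ltnNge => /negbTE->.
have vl z i : (0 < i)%N -> string_mx k w z *m string_v i =
    if z == (if odd i then zx else zy) then string_v i.+1 else 0.
  move=> i_gt0; have [le_i|lt_i] := leqP i l1; first exact: string_ev_l.
  by rewrite !v0 // ?mulmx0 ?if_same // ltnW.
have ur z i : (0 < i)%N -> string_mx k w z *m string_u i =
    if z == (if odd i then zy else zx) then string_u i.+1 else 0.
  move=> i_gt0; have [le_i|lt_i] := leqP i l2; first exact: string_ev_r.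
  by rewrite !u0 // ?mulmx0 ?if_same // ltnW.
have vu : string_v 0 = string_u 0 by rewrite /string_v /string_u subn0 addn0.
have ev0 : string_v 0 = ecol _ l1 by rewrite /string_v subn0.
split=> // [[|i]|i|[|i]|i|P Pv Pu].
- by rewrite ev0 string_ev0 eqxx.
- by rewrite vl //; case: odd; rewrite ?eqxx ?zyx.
- by rewrite vl //; case: odd; rewrite ?eqxx ?zxy.
- by rewrite -vu ev0 string_ev0 zxy.
- by rewrite ur //; case: odd; rewrite ?eqxx ?zxy.
- by rewrite ur //; case: odd; rewrite ?eqxx ?zyx.
apply: ecol_span => i; rewrite ltnS {1}sz => le_i; have [le_il|lt_li] := leqP i l1.
  have := Pv (l1 - i)%N; rewrite /string_v leq_subr.
  by have -> : (l1 - (l1 - i) = i)%N by lia.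
have := Pu (i - l1)%N; rewrite /string_u.
have -> : (i - l1 <= l2)%N by lia.
by have -> : (l1 + (i - l1) = i)%N by lia.
Qed.

Variable rho : k.
Hypotheses (rho_neq0 : rho != 0) (l1_gt0 : (0 < l1)%N) (l2_gt0 : (0 < l2)%N).

Local Notation n := (size w).

(** Both arms of a band end in [e_0]. The factor [rho] comes from [T e_1 = rho e_0], whereas the
    other arm arrives through [T^-1 e_(n-1) = e_0]. *)
Definition band_v i :=
  if (i < l1)%N then ecol n (l1 - i) else if i == l1 then rho *: ecol n 0 else 0.
Definition band_u i :=
  if (i < l2)%N then ecol n (l1 + i) else if i == l2 then ecol n 0 else 0.

Lemma band_T_ev i : (i < n)%N -> band_T n rho *m ecol n i =
  if i == 0%N then ecol n n.-1 else if i == 1%N then rho *: ecol n 0 else ecol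
    n i.-1.
Proof.
move=> lt_i; rewrite (mulmx_ecol _ (Ordinal lt_i)); apply/colP => j.
by rewrite !mxE /=; case: ifP => _; [|case: ifP => _]; rewrite !mxE.
Qed.

Lemma band_T_unit : band_T n rho \in unitmx.
Proof.
pose T' : 'M[k]_n := \matrix_(j, i) (if i == n.-1 :> nat then ecol n 0 else
  if i == 0%N :> nat then rho^-1 *: ecol n 1 else ecol n i.+1) j 0.
suff /mulmx1_unit[] : band_T n rho *m T' = 1%:M by [].
apply/subr0_eq/ecol_span => i lt_i; rewrite mulmxBl mul1mx -mulmxA.
have -> : T' *m ecol n i = if i == n.-1 :> nat then ecol n 0 else
    if i == 0%N :> nat then rho^-1 *: ecol n 1 else ecol n i.+1.
  by rewrite (mulmx_ecol _ (Ordinal lt_i)); apply/colP => j; rewrite !mxE.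
case: eqP => [->|ne_i]; first by rewrite band_T_ev ?subrr //; lia.
case: eqP => [->|i_neq0].
  by rewrite -scalemxAr band_T_ev ?scalerA ?mulVf ?scale1r ?subrr //; lia.
rewrite band_T_ev; last lia.
have -> : (i.+1 == 1%N) = false by lia.
by rewrite subrr.
Qed.

Lemma band_Tinv_ev i : (0 < i)%N -> (i < n)%N -> invmx (band_T n rho) *m ecol n i =
  if i == n.-1 then ecol n 0 else ecol n i.+1.
Proof.
move=> i_gt0 lt_i; case: eqP => [i_n|ne_i].
  have := band_T_ev (ltn_trans i_gt0 lt_i); rewrite eqxx -i_n => <-.
  by rewrite mulKmx // band_T_unit.
have lt_i1 : (i.+1 < n)%N by lia.
have := band_T_ev lt_i1; have -> /= : (i.+1 == 1%N) = false by lia.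
by move=> <-; rewrite mulKmx // band_T_unit.
Qed.

Lemma band_ev z i : (i < n)%N -> band_mx w rho z *m ecol n i =
  if clett w i == (z, false) then band_T n rho *m ecol n i
  else if clett w i.+1 == (z, true) then invmx (band_T n rho) *m ecol n i else 0.
Proof.
move=> lt_i; rewrite !(mulmx_ecol _ (Ordinal lt_i)); apply/colP => j.
by rewrite mxE mxE /=; case: ifP => _; [|case: ifP => _]; rewrite [RHS]mxE.
Qed.

Lemma band_ev_0 z : band_mx w rho z *m ecol n 0 = 0.
Proof.
have n_gt0 : (0 < n)%N by rewrite sz; lia.
rewrite band_ev // /clett eqxx /= /lett.
have -> : (nth (X, false) w n.-1 == (z, false)) = false.
  apply/negbTE/eqP => /(congr1 snd) /=. rewrite flag sz; lia.
have -> // : (nth (X, false) w 0 == (z, true)) = false.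
by apply/negbTE/eqP => /(congr1 snd) /=; rewrite flag; lia.
Qed.

Lemma band_ev_l z j : (0 < j)%N -> (j < l1)%N -> band_mx w rho z *m band_v j =
  if z == (if odd j then zx else zy) then band_v j.+1 else 0.
Proof.
move=> j_gt0 lt_j; rewrite /band_v lt_j band_ev; last by rewrite sz; lia.
have -> : (clett w (l1 - j).+1 == (z, true)) = false.
  apply/negbTE/eqP => /(congr1 snd) /=; rewrite /clett /lett /= flag; lia.
have -> : clett w (l1 - j) = (if odd j then zx else zy, false).
  rewrite /clett; have -> : (l1 - j == 0)%N = false by lia.
  by rewrite /lett nth_l.
rewrite xpair_eqE eqxx andbT eq_sym; case: eqP => // _.
rewrite band_T_ev; last by rewrite sz; lia.
have -> : (l1 - j == 0)%N = false by lia.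
have -> : (l1 - j == 1)%N = (j.+1 == l1) by lia.
case: eqP => [->|ne]; first by rewrite ltnn.
have -> : (j.+1 < l1)%N by lia.
by congr ecol; lia.
Qed.

Lemma band_ev_r z j : (0 < j)%N -> (j < l2)%N -> band_mx w rho z *m band_u j =
  if z == (if odd j then zy else zx) then band_u j.+1 else 0.
Proof.
move=> j_gt0 lt_j; rewrite /band_u lt_j band_ev; last by rewrite sz; lia.
have -> : (clett w (l1 + j) == (z, false)) = false.
  apply/negbTE/eqP => /(congr1 snd) /=; rewrite /clett /lett.
  have -> : (l1 + j == 0)%N = false by lia.
  by rewrite flag; lia.
rewrite {1}/clett /= /lett nth_r // xpair_eqE eqxx andbT eq_sym; case: eqP => // _.
rewrite band_Tinv_ev ?sz; try lia.
have -> : (l1 + j == (l1 + l2).-1)%N = (j.+1 == l2) by lia.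
case: eqP => [->|ne]; first by rewrite ltnn.
have -> : (j.+1 < l2)%N by lia.
by rewrite addnS.
Qed.

Lemma band_ev_top z : band_mx w rho z *m ecol n l1 =
  if z == zy then band_v 1 else band_u 1.
Proof.
have lt_ln : (l1 < n)%N by rewrite sz; lia.
rewrite band_ev //.
have -> : clett w l1 = (zy, false).
  have -> : clett w l1 = nth (X, false) w (l1 - 0).-1.
    by rewrite /clett /lett subn0; case: (l1) l1_gt0.
  by rewrite nth_l.
have -> : clett w l1.+1 = (zx, true).
  by have := nth_r (X, false) l2_gt0; rewrite addn0.
rewrite !xpair_eqE eqxx !andbT (eq_sym zy z) (eq_sym zx z).
have Hz : (z == zx) = ~~ (z == zy).
  by move: zxy; clear; case: z; case: zx; case: zy.
rewrite Hz; case: eqP => /= _.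
  rewrite band_T_ev // /band_v; have -> : (l1 == 0)%N = false by lia.
  rewrite (eq_sym 1%N); case: eqP => [->|ne]; first by [].
  have -> : (1 < l1)%N by lia.
  by rewrite subn1.
rewrite band_Tinv_ev // /band_u sz;
  have -> : (l1 == (l1 + l2).-1)%N = (1 == l2)%N by lia.
case: eqP => [<-|ne]; first by [].
have -> : (1 < l2)%N by lia.
by rewrite addn1.
Qed.

Lemma band_two_armed :
  two_armed (band_mx w rho zx) (band_mx w rho zy) band_v band_u.
Proof.
have v0 i : (l1 < i)%N -> band_v i = 0.
  by move=> lt_i; rewrite /band_v ltnNge ltnW //= gtn_eqF.
have u0 i : (l2 < i)%N -> band_u i = 0.
  by move=> lt_i; rewrite /band_u ltnNge ltnW //= gtn_eqF.
have vl z i : (0 < i)%N -> band_mx w rho z *m band_v i =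
    if z == (if odd i then zx else zy) then band_v i.+1 else 0.
  move=> i_gt0; have [lt_i|lt_i|->] := ltngtP i l1; first exact: band_ev_l.
    by rewrite !v0 // ?mulmx0 ?if_same // ltnW.
  rewrite [band_v l1]/band_v ltnn eqxx -scalemxAr band_ev_0 scaler0.
  by rewrite v0 ?if_same.
have ur z i : (0 < i)%N -> band_mx w rho z *m band_u i =
    if z == (if odd i then zy else zx) then band_u i.+1 else 0.
  move=> i_gt0; have [lt_i|lt_i|->] := ltngtP i l2; first exact: band_ev_r.
    by rewrite !u0 // ?mulmx0 ?if_same // ltnW.
  by rewrite [band_u l2]/band_u ltnn eqxx band_ev_0 u0 ?if_same.
have vu : band_v 0 = band_u 0 by rewrite /band_v /band_u l1_gt0 l2_gt0 subn0 addn0.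
have ev0 : band_v 0 = ecol _ l1 by rewrite /band_v l1_gt0 subn0.
split=> // [[|i]|i|[|i]|i|P Pv Pu].
- by rewrite ev0 band_ev_top eqxx.
- by rewrite vl //; case: odd; rewrite ?eqxx ?zyx.
- by rewrite vl //; case: odd; rewrite ?eqxx ?zxy.
- by rewrite -vu ev0 band_ev_top zxy.
- by rewrite ur //; case: odd; rewrite ?eqxx ?zxy.
- by rewrite ur //; case: odd; rewrite ?eqxx ?zyx.
apply: ecol_span => i; rewrite {1}sz => lt_i; have [i0|i_gt0] := posnP i.
  by have := Pu l2; rewrite /band_u ltnn eqxx i0.
have [le_il|lt_li] := leqP i l1.
  have := Pv (l1 - i)%N; rewrite /band_v; have -> : (l1 - i < l1)%N by lia.
  by have -> : (l1 - (l1 - i) = i)%N by lia.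
have := Pu (i - l1)%N; rewrite /band_u.
have -> : (i - l1 < l2)%N by lia.
by have -> : (l1 + (i - l1) = i)%N by lia.
Qed.

End Word.
End Columns.

(** * The radical of the group algebra *)

Section GroupAlgebra.

Variables (k : fieldType) (k_char2 : 2%N \in [pchar k]).
Variables (gT : finGroupType) (G : {group gT}) (r : nat) (g h : gT).
Hypotheses (gh_gen : <<[set g;
  h]>>%g = G) (gg : (g * g = 1)%g) (hh : (h * h = 1)%g).
Hypothesis gh_exp : ((g * h) ^+ (2 ^ r) = 1)%g.

Local Notation kG := (group_ring k G).
Local Notation aG := (regular_repr k G).
Local Notation addxx := (@mx_addxx _ k_char2 _).

Let Gg : g \in G. Proof. by rewrite -gh_gen mem_gen // !inE eqxx. Qed.
Let Gh : h \in G. Proof. by rewrite -gh_gen mem_gen // !inE eqxx orbT. Qed.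

Lemma repr_add1_sqr0 d (rG : mx_representation k G d) z : z \in G ->
  (z * z = 1)%g -> (1 + rG z) * (1 + rG z) = 0 :> 'M_d.
Proof.
move=> Gz zz; have rzz : rG z * rG z = 1 :> 'M_d.
  by rewrite -[LHS](repr_mxM rG Gz Gz) zz repr_mx1.
by rewrite mulrDl mul1r mulrDr mulr1 rzz [rG z + 1]addrC addxx.
Qed.

Lemma sqr_pow2D d (a b : 'M[k]_d) n : GRing.comm a b ->
  (a + b) ^+ (2 ^ n) = a ^+ (2 ^ n) + b ^+ (2 ^ n).
Proof.
move=> ab; elim: n => [|n IHn]; first by rewrite !expr1.
rewrite expnSr !exprM IHn !expr2 mulrDl !mulrDr.
have -> : b ^+ (2 ^ n) * a ^+ (2 ^ n) = a ^+ (2 ^ n) * b ^+ (2 ^ n).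
  by apply/commr_sym/commrX/commr_sym/commrX.
by rewrite addrA -[X in X + _]addrA addxx addr0.
Qed.

Lemma mxZAl d c (a b : 'M[k]_d) : (c *: a) * b = c *: (a * b).
Proof. by rewrite -[LHS]scalemxAl. Qed.

Lemma mxZAr d c (a b : 'M[k]_d) : a * (c *: b) = c *: (a * b).
Proof. by rewrite -[LHS]scalemxAr. Qed.

Section Repr.

Variables (d : nat) (rG : mx_representation k G d).
Local Notation x := (1 + rG g : 'M_d).
Local Notation y := (1 + rG h : 'M_d).

(** By Frobenius, [alpha ^ (2 ^ r) = 1 + (h g) ^ (2 ^ r) = 0]. *)
Lemma alt_word_repr_eq0 : alt_word x y (2 ^ r).+1 = 0 /\ alt_word y x (2 ^
  r).+1 = 0.
Proof.
apply/(alt_word_eq0_alpha addxx (repr_add1_sqr0 rG Gg gg) (repr_add1_sqr0 rG Gh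
  hh)).
suff a0 : alpha x y ^+ (2 ^ r) = 0 by rewrite exprS a0 mulr0 mul0r.
rewrite /alpha !addrA !addxx !add0r sqr_pow2D; last exact: commr_sym (commr1 _).
have hgX n : (rG h * rG g : 'M_d) ^+ n = rG ((h * g) ^+ n)%g.
  elim: n => [|n IHn]; first by rewrite expg0 repr_mx1.
  rewrite exprS IHn expgS repr_mxM ?groupX ?groupM //.
  by rewrite repr_mxM.
have hg_inv : (h * g = (g * h)^-1)%g.
  by apply/eqP; rewrite eq_sym eq_invg_mul mulgA -(mulgA g) hh mulg1 gg.
by rewrite hgX hg_inv expgVn gh_exp invg1 repr_mx1 expr1n addxx.
Qed.

End Repr.

Local Notation x := (1 + aG g : 'M_#|G|).
Local Notation y := (1 + aG h : 'M_#|G|).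

Let xx : x * x = 0. Proof. exact: repr_add1_sqr0. Qed.
Let yy : y * y = 0. Proof. exact: repr_add1_sqr0. Qed.

(** The n-th power of the augmentation ideal, as the span of the words of length at least [n]; the
    lemmas below compare it with the n-th power of the radical. *)
Inductive long_words (n : nat) : 'M[k]_#|G| -> Prop :=
| LongA m of (n <= m)%N : long_words n (alt_word x y m)
| LongB m of (n <= m)%N : long_words n (alt_word y x m)
| LongZ c a of long_words n a : long_words n (c *: a)
| LongD a b of long_words n a & long_words n b : long_words n (a + b).

Lemma long_words_leq m n a : (m <= n)%N -> long_words n a -> long_words m a.
Proof.
move=> mn; elim=> {a} [i ni|i ni|c a _ IH|a b _ IHa _ IHb].
- exact/LongA/(leq_trans mn).
- exact/LongB/(leq_trans mn).
- exact: LongZ.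
exact: LongD.
Qed.

Lemma long_words0 n : long_words n 0.
Proof. by rewrite -(scale0r (alt_word x y n)); apply/LongZ/LongA. Qed.

Lemma long_words_step n a : long_words n a ->
  long_words n.+1 (x * a) /\ long_words n.+1 (y * a).
Proof.
elim=> {a} [[|m] nm|[|m] nm|c a _ [IHx IHy]|a b _ [IHax IHay] _ [IHbx IHby]].
- by split; [apply: (@LongB _ 1) | apply: (@LongA _ 1)].
- have [-> ->] := alt_word_step m xx yy.
  by split; case: odd; (exact: long_words0 || exact: LongA).
- by split; [apply: (@LongB _ 1) | apply: (@LongA _ 1)].
- have [-> ->] := alt_word_step m yy xx.
  by split; case: odd; (exact: long_words0 || exact: LongB).
- by rewrite !mxZAr; split; apply: LongZ.
by rewrite !mulrDr; split; apply: LongD.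
Qed.

Lemma long_words_mul m n a b : long_words m a -> long_words n b ->
  long_words (m + n) (a * b).
Proof.
move=> + lb; have wdb i : long_words (i + n) (alt_word x y i * b) /\
    long_words (i + n) (alt_word y x i * b).
  elim: i => [|i [IHa IHb]]; first by rewrite /= mul1r.
  have [[xa ya] [xb yb]] := (long_words_step IHa, long_words_step IHb).
  by rewrite /= -!mulrA; split; case: odd.
elim=> {a} [i mi|i mi|c a _ IH|a a' _ IH _ IH'].
- by apply: long_words_leq (wdb i).1; rewrite leq_add2r.
- by apply: long_words_leq (wdb i).2; rewrite leq_add2r.
- by rewrite mxZAl; apply: LongZ.
by rewrite mulrDl; apply: LongD.
Qed.

Lemma long_words_eq0 a : long_words (2 ^ r).+1 a -> a = 0.
Proof.
have [wx wy] := alt_word_repr_eq0 aG.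
elim=> {a} [m /subnK <-|m /subnK <-|c a _ ->|a b _ -> _ ->].
- by elim: (m - _)%N => // i IH; rewrite addSn; apply: alt_word_eq0S.
- by elim: (m - _)%N => // i IH; rewrite addSn; apply: alt_word_eq0S.
- exact: scaler0.
exact: addr0.
Qed.

Lemma mem_kGZ c a : (a \in kG)%MS -> (c *: a \in kG)%MS.
Proof. by move=> Ra; rewrite linearZ scalemx_sub. Qed.

Lemma mem_kGD a b : (a \in kG)%MS -> (b \in kG)%MS -> (a + b \in kG)%MS.
Proof. by move=> Ra Rb; rewrite linearD addmx_sub. Qed.

Lemma mem_gens : (x \in kG)%MS /\ (y \in kG)%MS.
Proof. by split; apply: mem_kGD; rewrite ?envelop_mx_id //; apply: envelop_mx1. Qed.

Lemma mem_wd n : (alt_word x y n \in kG)%MS /\ (alt_word y x n \in kG)%MS.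
Proof.
have [Rx Ry] := mem_gens.
elim: n => [|n [IHa IHb]]; first by split; apply: envelop_mx1.
by split=> /=; apply: envelop_mxM => //; case: odd.
Qed.

Lemma long_words_kG n a : long_words n a -> (a \in kG)%MS.
Proof.
elim=> {a} [m _|m _|c a _|a b _ Ra _ Rb];
  [exact: (mem_wd m).1 | exact: (mem_wd m).2 | | ].
  exact: mem_kGZ.
exact: mem_kGD.
Qed.

Lemma kG_long_words a : (a \in kG)%MS -> long_words 0 a.
Proof.
have one : long_words 0 (1 : 'M_#|G|) by exact: (@LongA _ 0).
have elt z : z \in G -> long_words 0 (aG z).
  rewrite -{1}gh_gen => /gen_prodgP[n [c cgh ->]].
  have Gc i : c i \in G by rewrite -gh_gen; apply/mem_gen/cgh.
  elim: n c cgh Gc => [|n IHn] c cgh Gc.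
    by rewrite big_ord0 repr_mx1.
  rewrite big_ord_recl repr_mxM ?group_prod //.
  apply: (@long_words_mul 0 0); last by apply: IHn.
  have fold (u : 'M[k]_#|G|) : 1 + (1 + u) = u by rewrite addrA addxx add0r.
  have := cgh ord0; rewrite !inE => /orP[] /eqP->.
    by rewrite -[aG g]fold; apply: LongD => //; rewrite -[x]mulr1;
      apply: (@LongB 0 1).
  by rewrite -[aG h]fold; apply: LongD => //; rewrite -[y]mulr1;
    apply: (@LongA 0 1).
move/envelop_mxP=> [c ->]; elim/big_ind: _ => [|u v|z Gz].
- exact: long_words0.
- exact: LongD.
exact/LongZ/elt.
Qed.

Lemma long_words0P a : long_words 0 a -> exists c b, long_words 1 b /\ a = c *:
  (1 : 'M_#|G|) + b.
Proof.
elim=> {a} [[|m] _|[|m] _|c a _ [c' [b [lb ->]]]|a a' _ [c [b [lb ->]]] _ [c'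
  [b' [lb' ->]]]].
- by exists 1, 0; rewrite scale1r addr0; split=> //; exact: long_words0.
- by exists 0, (alt_word x y m.+1); rewrite scale0r add0r; split=> //; exact: LongA.
- by exists 1, 0; rewrite scale1r addr0; split=> //; exact: long_words0.
- by exists 0, (alt_word y x m.+1); rewrite scale0r add0r; split=> //; exact: LongB.
- by exists (c * c'), (c *: b); rewrite scalerDr scalerA; split=> //; exact: LongZ.
by exists (c + c'), (b + b'); rewrite scalerDl addrACA; split=> //; exact: LongD.
Qed.

(* An element with nonzero augmentation is invertible, as in characteristic 2
   its 2^n-th power is a scalar for large n. *)
Lemma long_words1_unit c b : c != 0 -> long_words 1 b ->
  exists2 u, (u \in kG)%MS & u * (c *: (1 : 'M_#|G|) + b) = 1.
Proof.
move=> c0 lb; pose n := (2 ^ r).+1; set a := _ + b.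
have lbX m : long_words m (b ^+ m).
  elim: m => [|m IHm]; first exact: (@LongA _ 0).
  by rewrite exprS -add1n; apply: long_words_mul.
have bn : b ^+ (2 ^ n) = 0.
  by apply: long_words_eq0; apply: long_words_leq (lbX _); apply/ltnW/ltn_expl.
have an : a ^+ (2 ^ n) = (c ^+ (2 ^ n)) *: (1 : 'M_#|G|).
  rewrite sqr_pow2D; last by rewrite /GRing.comm mxZAl mxZAr mul1r mulr1.
  rewrite bn addr0; elim: (2 ^ n)%N => [|m IHm]; first by rewrite scale1r.
  by rewrite !exprS IHm mxZAl mxZAr mul1r scalerA.
have Ra : (a \in kG)%MS.
  by apply: mem_kGD; [apply/mem_kGZ/envelop_mx1 | apply: long_words_kG lb].
exists ((c ^- (2 ^ n)) *: a ^+ (2 ^ n).-1).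
  apply: mem_kGZ; elim: (_.-1) => [|m IHm]; first exact: envelop_mx1.
  by rewrite exprS; apply: envelop_mxM.
rewrite mxZAl -exprSr prednK ?expn_gt0 // an scalerA mulVf ?scale1r //.
by rewrite expf_neq0.
Qed.

Lemma left_ideal_unit (I : 'A[k]_#|G|) c b : left_ideal I -> (I < kG)%MS ->
  long_words 1 b -> (c *: (1 : 'M_#|G|) + b \in I)%MS -> c = 0.
Proof.
move=> [IR idI] ltI lb Ia; apply/eqP; apply: contraTT ltI => c0.
have [u Ru ua] := long_words1_unit c0 lb.
have memI z w : (z \in kG)%MS -> (w \in I)%MS -> (z * w \in I)%MS.
  exact: (mulsmx_subP idI).
rewrite /ltmx negb_and negbK; apply/orP; right; apply/memmx_subP => z Rz.
by rewrite -[z]mulr1 -ua; apply/memI/memI.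
Qed.

(** An intersection over no ideals would make the radical all of [kG]. A proper left ideal of
    largest rank is maximal. *)
Lemma ex_maximal_left_ideal : exists I : 'A[k]_#|G|, maximal_left_ideal I.
Proof.
pose P n := `[< exists I : 'A[k]_#|G|, [/\ left_ideal I, (I < kG)%MS & \rank I
  = n] >].
have exP : exists n, P n.
  exists 0%N; apply/asboolP; exists 0; split; last exact: mxrank0.
    by split; [exact: sub0mx | rewrite /left_mx_ideal mulsmx0 sub0mx].
  rewrite lt0mx; apply/eqP => R0.
  have R1 : (1%:M \in kG)%MS := envelop_mx1 aG.
  have E : 1%:M = 0 :> 'M[k]_#|G|.
    by rewrite R0 in R1; apply: (can_inj mxvecK); rewrite linear0;
      exact: submx0null R1.
  have := congr1 (fun M : 'M_#|G| => M (enum_rank_in Gg g) (enum_rank_in Gg g)) E.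
  by rewrite !mxE eqxx => /eqP; rewrite oner_eq0.
have boundP n : P n -> (n <= #|G| ^ 2)%N.
  by case/asboolP => I [_ _ <-]; apply: rank_leq_row.
case: (ex_maxnP exP boundP) => n /asboolP[I [idI ltI rI]] max.
exists I; split=> // J idJ leIJ ltJ.
have := max (\rank J); rewrite -rI => leJ.
rewrite -(geq_leqif (mxrank_leqif_sup leIJ)); apply: leJ.
by apply/asboolP; exists J.
Qed.

Lemma in_rad_long_words a : in_rad a -> long_words 1 a.
Proof.
case=> Ra radI; have [c [b [lb E]]] := long_words0P (kG_long_words Ra).
have [I maxI] := ex_maximal_left_ideal; have [idI ltI _] := maxI.
have := radI I maxI; rewrite E => /(left_ideal_unit idI ltI lb) ->.
by rewrite scale0r add0r.
Qed.

(** If a maximal [I] missed [z], then [I + kG z] would be everything and [1 = i + u z] with [i] in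
    [I]; but [i = 1 + u z] is invertible. *)
Lemma long_words_in_rad z : (z \in kG)%MS -> long_words 1 z -> in_rad z.
Proof.
move=> Rz lz; split=> // I [idI ltI maxI]; have [IR cI] := idI.
pose J : 'A[k]_#|G| := (I + kG * mxvec z)%MS.
have zP w : (w \in kG * mxvec z)%MS -> exists2 u, (u \in kG)%MS & w = u * z.
  case/mulsmxP=> A1 RA1 [A2 zA2 ->]; have A2E i : exists c, A2 i = c *: z.
    by have /sub_rVP[c E] := zA2 i; exists c; apply: (can_inj mxvecK);
      rewrite linearZ.
  elim/big_ind: _ => [|v v' [u Ru ->] [u' Ru' ->]|i _].
  - by exists 0; rewrite ?mul0r // linear0 sub0mx.
  - by exists (u + u'); rewrite ?mulrDl //; apply: mem_kGD.
  have [c ->] := A2E i; exists (c *: A1 i); first exact: mem_kGZ.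
  by rewrite -[A1 i *m _]/(A1 i * _) mxZAr mxZAl.
have idJ : left_ideal J.
  split.
    rewrite addsmx_sub IR; apply/mulsmx_subP => a b Ra.
    case/sub_rVP=> c E; apply: envelop_mxM => //.
    by rewrite E scalemx_sub.
  apply/mulsmx_subP => a b Ra /memmx_addsP[[i w] [/= Ii Iw ->]].
  have [u Ru Ew] := zP _ Iw; apply/memmx_addsP; exists (a *m i, a *m u *m z).
  split=> /=; first exact: (mulsmx_subP cI).
    by apply: mem_mulsmx; [exact: envelop_mxM | exact: submx_refl].
  by rewrite mulmxDr Ew -mulmxA.
have zJ : (z \in J)%MS.
  apply: submx_trans (addsmxSr _ _); rewrite -[z]mul1mx.
  by apply: mem_mulsmx; [exact: envelop_mx1 | rewrite mul1mx submx_refl].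
have [ltJ|geJ] := boolP (J < kG)%MS.
  exact: submx_trans zJ (maxI J idJ (addsmxSl _ _) ltJ).
have J1 : (1 \in J)%MS.
  move: geJ; rewrite /ltmx idJ.1 /= negbK => leJ.
  exact: submx_trans (envelop_mx1 aG) leJ.
have [[i w] [/= Ii Iw E]] := memmx_addsP _ J1.
have [u Ru Ew] := zP _ Iw.
have l1 : long_words 1 w by rewrite Ew; apply: (@long_words_mul 0 1) => //;
  apply: kG_long_words.
have Ei : i = 1 *: (1 : 'M_#|G|) + w by rewrite scale1r E -addrA addxx addr0.
have := @left_ideal_unit I 1 w idI ltI l1; rewrite -Ei => /(_ Ii)/eqP.
by rewrite oner_eq0.
Qed.

Lemma in_rad_exp_long_words n a : in_rad_exp n a -> long_words n a.
Proof.
elim=> {n a} [a|n a b ra _ IH|n a b _ IHa _ IHb]; first exact: kG_long_words.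
  by rewrite -add1n; apply: long_words_mul => //; apply: in_rad_long_words.
exact: LongD.
Qed.

Lemma alt_word_in_rad_exp n : in_rad_exp n (alt_word x y n) /\ in_rad_exp n
  (alt_word y x n).
Proof.
have [Rx Ry] := mem_gens.
have rx : in_rad x by apply: long_words_in_rad => //; rewrite -[x]mulr1;
  apply: (@LongB 1 1).
have ry : in_rad y by apply: long_words_in_rad => //; rewrite -[y]mulr1;
  apply: (@LongA 1 1).
elim: n => [|n [IHa IHb]]; first by split; apply/RadExp0/envelop_mx1.
by split=> /=; apply: RadExpM => //; case: odd.
Qed.

Section Kill.

Variables (d : nat) (rG : mx_representation k G d).
Local Notation X := (1 + rG g : 'M_d).
Local Notation Y := (1 + rG h : 'M_d).

Lemma gring_op_wd n : gring_op rG (alt_word x y n) = alt_word X Y n /\ gring_op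
  rG (alt_word y x n) = alt_word Y X n.
Proof.
have ox : gring_op rG x = X by rewrite linearD /= gring_op1 gring_opG.
have oy : gring_op rG y = Y by rewrite linearD /= gring_op1 gring_opG.
elim: n => [|n [IHa IHb]]; first by split; apply: gring_op1.
have [Ra Rb] := mem_wd n; split=> /=;
  rewrite -[_ * alt_word _ _ n]/(_ *m _) gring_opM //.
  by rewrite IHa; case: odd; rewrite ?ox ?oy.
by rewrite IHb; case: odd; rewrite ?ox ?oy.
Qed.

Lemma rad_exp_killsP n : rad_exp_kills rG n <-> alt_word X Y n = 0 /\ alt_word
  Y X n = 0.
Proof.
split=> [kill|[wX wY] a /in_rad_exp_long_words la v].
  have zero (M : 'M[k]_d) : (forall v : 'cV_d, M *m v = 0) -> M = 0.
    move=> Mv; apply/matrixP => i j; have := Mv (delta_mx j 0).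
    by rewrite -colE => /colP/(_ i); rewrite !mxE.
  have [oa ob] := gring_op_wd n; have [ra rb] := alt_word_in_rad_exp n.
  by split; apply: zero => v; rewrite -?oa -?ob; apply: kill.
suff -> : gring_op rG a = 0 by rewrite mul0mx.
elim: la => {a} [m /subnK <-|m /subnK <-|c a _|a b _ IHa _ IHb].
- by rewrite (gring_op_wd _).1; elim: (m - n)%N => // i IH; rewrite addSn;
  apply: alt_word_eq0S.
- by rewrite (gring_op_wd _).2; elim: (m - n)%N => // i IH; rewrite addSn;
  apply: alt_word_eq0S.
- by rewrite linearZ /= => ->; rewrite scaler0.
by rewrite linearD /= IHa IHb addr0.
Qed.

Lemma rad_exp_kills0 : (0 < d)%N -> ~ rad_exp_kills rG 0.
Proof.
move=> d_gt0 /rad_exp_killsP[/= E _].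
have := congr1 (fun M : 'M_d => M (Ordinal d_gt0) (Ordinal d_gt0)) E.
by rewrite !mxE eqxx => /eqP; rewrite oner_eq0.
Qed.

(** Words start at length 0, so a longest nonzero word of length [n] means Loewy length [n + 1]. *)
Lemma loewy_length_eq n : (0 < d)%N -> loewy_eq X Y n -> loewy_length rG = n.+1.
Proof.
move=> d_gt0 [le_n min_n]; rewrite /loewy_length; case: pselect => [ex|[]];
  last first.
  by exists n.+1; apply/asboolP/rad_exp_killsP.
case: ex_minnP => [[|m] /asboolP kill_m min_m];
  first by have := rad_exp_kills0 d_gt0.
apply/eqP; rewrite eqSS eqn_leq (min_n m) ?andbT; last exact/rad_exp_killsP.
by rewrite -ltnS; apply: min_m; apply/asboolP/rad_exp_killsP.
Qed.

End Kill.

Lemma loewy_length_ext d d' (rG : mx_representation k G d)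
    (rG' : mx_representation k G d') : (0 < d)%N -> (0 < d')%N ->
  (forall n, loewy_le (1 + rG g : 'M_d) (1 + rG h) n <->
             loewy_le (1 + rG' g : 'M_d') (1 + rG' h) n) ->
  loewy_length rG = loewy_length rG'.
Proof.
move=> d_gt0 d'_gt0 ext; have E n : rad_exp_kills rG n <-> rad_exp_kills rG' n.
  case: n => [|n]; last by rewrite !rad_exp_killsP; apply: ext.
  by split=> /rad_exp_kills0.
rewrite /loewy_length; case: pselect => [ex|nex]; case: pselect => [ex'|nex'] //.
- case: ex_minnP => n /asboolP/E kn min_n; case: ex_minnP => m /asboolP/E km min_m.
  by apply/eqP; rewrite eqn_leq min_n ?min_m //; apply/asboolP.
- by case: nex'; case: ex => n /asboolP/E kn; exists n; apply/asboolP.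
by case: nex; case: ex' => n /asboolP/E kn; exists n; apply/asboolP.
Qed.

End GroupAlgebra.

(** * Socle words and alpha-powers on strings and bands *)

Section Modules.

Variable k : fieldType.

(** Vectors enter the tensor arguments as square matrices, since [tensor_like] speaks of square
    matrices only; repeating the column is such an encoding. *)
Lemma outer_neq0 d (v : 'cV[k]_d) : v != 0 -> v *m const_mx 1 != 0 :> 'M_d.
Proof.
case/matrix0Pn=> i [j vij]; apply/matrix0Pn; exists i, i.
by rewrite mxE big_ord1 mxE mulr1; move: vij; rewrite (ord1 j).
Qed.

Lemma two_armed_same_ann d d' (x y : 'M[k]_d) (x' y' : 'M[k]_d') v u v' u' l :
  two_armed x y v u -> two_armed x' y' v' u' -> (0 < l)%N ->
  v l != 0 -> v' l != 0 ->
  (forall i, (l < i)%N -> v i = 0 /\ v' i = 0) ->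
  (forall i, (l <= i)%N -> u i = 0 /\ u' i = 0) ->
  same_ann x y x' y'.
Proof.
move=> M M' l_gt0 vl vl' v0 u0 n a b.
rewrite (word_comb_eq0 M l_gt0 vl) => [|i /v0[]|i /u0[]] //.
by rewrite (word_comb_eq0 M' l_gt0 vl') => [|i /v0[]|i /u0[]].
Qed.

(** At length [n] both words kill every arm vector except the generator, so one comparison there
    suffices. *)
Lemma alt_word_top_eq d (x y : 'M[k]_d) v u n c : two_armed x y v u -> (0 < n)%N ->
  (forall i, (n < i)%N -> v i = 0 /\ u i = 0) -> v n = c *: u n ->
  alt_word x y n = c *: alt_word y x n.
Proof.
case: n => // n M _ vu0 vc; have M' := two_armedC M;
  apply/subr0_eq/(arm_span M) => i.
  rewrite mulmxBl -scalemxAl; case: i => [|i].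
    by rewrite (alt_word_arm_even _ M) // (arm0 M) (alt_word_arm_even _ M') //
      add0n vc subrr.
  have [vi _] := vu0 (i.+1 + n.+1)%N ltac:(lia).
  have [od|ecol] := boolP (odd i.+1).
    by rewrite (alt_word_arm_odd0 _ M) // (alt_word_arm_odd _ M) // vi scaler0
      subrr.
  by rewrite (alt_word_arm_even0 _ M) // (alt_word_arm_even _ M) // vi scaler0
    subrr.
rewrite mulmxBl -scalemxAl; case: i => [|i].
  by rewrite -(arm0 M) (alt_word_arm_even _ M) // (arm0 M) (alt_word_arm_even _
    M') // add0n vc subrr.
have [_ ui] := vu0 (i.+1 + n.+1)%N ltac:(lia).
have [od|ecol] := boolP (odd i.+1).
  by rewrite (alt_word_arm_odd0 _ M') // (alt_word_arm_odd _ M') // ui scaler0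
    subrr.
by rewrite (alt_word_arm_even0 _ M') // (alt_word_arm_even _ M') // ui scaler0
  subrr.
Qed.

(* M(A_l), with zx, zy in the roles of X, Y *)
Lemma uniserial_facts w l zx zy : two_armed_word w l 0 zx zy ->
  let x := string_mx k w zx in let y := string_mx k w zy in
  [/\ x * x = 0, y * y = 0, loewy_le x y l, (0 < l)%N -> alt_word y x l = 0
    & exists e, x * e = 0 /\ alt_word x y l * e != 0].
Proof.
move=> wP x y; have M := string_two_armed k wP; have M' := two_armedC M.
have v0 i : (l < i)%N -> string_v k w l i = 0 by rewrite /string_v ltnNge =>
  /negbTE->.
have u0 i : (0 < i)%N -> string_u k w l 0 i = 0 by rewrite /string_u ltnNge =>
  /negbTE->.
have vl : string_v k w l l != 0 by rewrite /string_v leqnn ecol_neq0 // subnn.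
have vu i : (l < i)%N -> string_v k w l i = 0 /\ string_u k w l 0 i = 0.
  by move=> lt_i; rewrite v0 ?u0 //; lia.
split; [exact: two_armed_sqr0 M | exact: two_armed_sqr0 M' | | | ].
- exact: two_armed_loewy M vu.
- move=> l_gt0; apply: (alt_word_eq0 M') => //; first exact: u0.
  by move=> i /vu[-> ->].
exists (string_v k w l 0 *m const_mx 1); split.
  by rewrite -[x * _]/(x *m _) mulmxA (arm0 M) (arm_xu M) /= u0 // mul0mx.
by rewrite -[alt_word x y l * _]/(alt_word x y l *m _) mulmxA
  (alt_word_arm_even _ M) // outer_neq0.
Qed.

Lemma band_facts w l zx zy (rho : k) : two_armed_word w l l zx zy -> (0 < l)%N ->
  rho != 0 ->
  let x := band_mx w rho zx in let y := band_mx w rho zy in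
  [/\ x * x = 0, y * y = 0, loewy_le x y l, alt_word y x l != 0
    & alt_word x y l = rho *: alt_word y x l].
Proof.
move=> wP l_gt0 rho0 x y; have M := band_two_armed wP rho0 l_gt0 l_gt0.
have M' := two_armedC M; have sz : size w = (l + l)%N by case: wP.
have vu i : (l < i)%N -> band_v w l rho i = 0 /\ band_u k w l l i = 0.
  by move=> lt_i; rewrite /band_v /band_u ltnNge ltnW //= gtn_eqF.
have ul : band_u k w l l l != 0 by rewrite /band_u ltnn eqxx ecol_neq0 // sz; lia.
split; [exact: two_armed_sqr0 M | exact: two_armed_sqr0 M'
       | exact: two_armed_loewy M vu | exact: two_armed_wd_neq0 M' ul | ].
by apply: (alt_word_top_eq M) => //; rewrite /band_v /band_u !ltnn !eqxx.
Qed.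

Hypothesis k_char2 : 2%N \in [pchar k].
Local Notation addxx := (@mx_addxx _ k_char2 _).

Lemma uniserial_alpha d (x y e : 'M[k]_d) l : x * x = 0 -> y * y = 0 ->
  loewy_le x y l -> x * e = 0 -> alt_word x y l * e != 0 ->
  [/\ alt_word x y l != 0, alpha x y ^+ l != 0 & alpha y x ^+ l != 0].
Proof.
move=> xx yy xyl xe; have [E1 E2] := alphaX_fix k_char2 xx yy xyl xe.
by move=> ne; split; [move: ne | move: ne; rewrite -E1 | move: ne; rewrite -E2];
  apply: contraNneq => ->; rewrite mul0r.
Qed.

Lemma double_string_facts w l zx zy : two_armed_word w l l zx zy -> (0 < l)%N ->
  let x := string_mx k w zx in let y := string_mx k w zy in
  [/\ x * x = 0, y * y = 0, loewy_le x y l, alt_word y x l != 0 & alpha x y ^+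
    l != 0].
Proof.
move=> wP l_gt0 x y; have M := string_two_armed k wP; have M' := two_armedC M.
have sz : size w = (l + l)%N by case: wP.
have vu i : (l < i)%N -> string_v k w l i = 0 /\ string_u k w l l i = 0.
  by rewrite /string_v /string_u ltnNge => /negbTE->.
have ul : string_u k w l l l != 0 by rewrite /string_u leqnn ecol_neq0 // sz; lia.
have xx := two_armed_sqr0 M; have yy := two_armed_sqr0 M'.
have xyl := two_armed_loewy M vu.
split=> //; first exact: two_armed_wd_neq0 M' ul.
rewrite (alphaX_socle addxx xx yy) //; apply/eqP => E.
(* On the generator, [alpha ^ l] gives the sum of the two arm ends [e_0] and [e_(2 l)], which are
   distinct, unlike in a band. *)
have := congr1 (mulmx^~ (string_v k w l 0)) E.
rewrite mulmxDl mul0mx (alt_word_arm_even _ M) // (arm0 M) (alt_word_arm_even _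
  M') // add0n.
rewrite /string_u /string_v !leqnn subnn => /colP/(_ ord0); rewrite !mxE eqxx /=.
have -> : (0 == l + l)%N = false by lia.
by rewrite add0r => /eqP; rewrite oner_eq0.
Qed.

(** The longer arm determines the annihilator; if it is the second one, x and y exchange roles. *)
Lemma band_string_loewy w l1 l2 zx zy (rho : k) d2 (x2 y2 : 'M[k]_d2) n :
  two_armed_word w l1 l2 zx zy -> (0 < l1)%N -> (0 < l2)%N -> rho != 0 -> l1 <>
    l2 ->
  let tens d (x y : 'M[k]_d) :=
    loewy_le (1 + tprod (1 + x) (1 + x2)) (1 + tprod (1 + y) (1 + y2)) n in
  tens _ (band_mx w rho zx) (band_mx w rho zy) <->
  tens _ (string_mx k w zx) (string_mx k w zy).
Proof.
move=> wP l1_gt0 l2_gt0 rho0 ne tens.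
have sz : size w = (l1 + l2)%N by case: wP.
have M := band_two_armed wP rho0 l1_gt0 l2_gt0; have M1 := string_two_armed k wP.
have M' := two_armedC M; have M1' := two_armedC M1.
have xx := two_armed_sqr0 M; have yy := two_armed_sqr0 M'.
have xx1 := two_armed_sqr0 M1; have yy1 := two_armed_sqr0 M1'.
have bv0 i : (l1 < i)%N -> band_v w l1 rho i = 0.
  by move=> lt_i; rewrite /band_v ltnNge ltnW //= gtn_eqF.
have bu0 i : (l2 < i)%N -> band_u k w l1 l2 i = 0.
  by move=> lt_i; rewrite /band_u ltnNge ltnW //= gtn_eqF.
have sv0 i : (l1 < i)%N -> string_v k w l1 i = 0 by rewrite /string_v ltnNge =>
  /negbTE->.
have su0 i : (l2 < i)%N -> string_u k w l1 l2 i = 0 by rewrite /string_u ltnNge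
  => /negbTE->.
have [lt21|lt12|E] := ltngtP l2 l1; last by case: ne.
  apply: (loewy_le_same_ann k_char2) => //; apply: (two_armed_same_ann M M1 l1_gt0).
  - by rewrite /band_v ltnn eqxx scaler_eq0 negb_or rho0 ecol_neq0 // sz; lia.
  - by rewrite /string_v leqnn ecol_neq0 // subnn.
  - by move=> i lt_i; rewrite bv0 ?sv0.
  - by move=> i le_i; rewrite bu0 ?su0 //; lia.
have swap d (x y : 'M[k]_d) : tens _ x y <->
    loewy_le (1 + tprod (1 + y) (1 + y2)) (1 + tprod (1 + x) (1 + x2)) n.
  by split; apply: loewy_leC.
rewrite !swap; apply: (loewy_le_same_ann k_char2) => //.
apply: (two_armed_same_ann M' M1' l2_gt0).
- by rewrite /band_u ltnn eqxx ecol_neq0 // sz; lia.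
- by rewrite /string_u leqnn ecol_neq0 // sz; lia.
- by move=> i lt_i; rewrite bu0 ?su0.
by move=> i le_i; rewrite bv0 ?sv0 //; lia.
Qed.

End Modules.

(** * Loewy lengths over the dihedral group algebra *)

Section Dihedral.

Variables (k : fieldType) (k_char2 : 2%N \in [pchar k]).
Variables (q : nat) (q_2power : (2.-nat q)%N) (g h : 'D_(4 * q)).
Hypothesis gh_gen : dihedral_generators g h.

Local Notation kD := (mx_representation k ('D_(4 * q))%G).

Lemma add1_repr d1 d2 (M : kD d1) (N : kD d2) z xM xN :
  1%:M + M z = xM -> 1%:M + N z = xN ->
  (1 + prod_repr M N z : 'M_(d1 * d2)) = 1 + tprod (1 + xM) (1 + xN).
Proof.
have add11 d (u : 'M[k]_d) : 1 + (1 + u) = u by rewrite addrA mx_addxx // add0r.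
by move=> <- <-; rewrite !add11.
Qed.

Let gensP : [/\ <<[set g; h]>>%g = ('D_(4 * q))%G :> {set _}, (g * g = 1)%g,
  (h * h = 1)%g & exists r, ((g * h) ^+ (2 ^ r) = 1)%g].
Proof.
case: gh_gen => gen gg hh gh; split=> //.
have /p_natP[r qr] := q_2power.
by exists r.+1; rewrite expnS -qr.
Qed.

Lemma tensor_loewy_length d1 d2 (M : kD d1) (N : kD d2) (fM : gen -> 'M_d1)
    (fN : gen -> 'M_d2) n : (0 < d1)%N -> (0 < d2)%N ->
  XY_act g h M fM -> XY_act g h N fN ->
  loewy_eq (1 + tprod (1 + fM X) (1 + fN X)) (1 + tprod (1 + fM Y) (1 + fN Y)) n ->
  'l(M ⊗ N) = n.+1.
Proof.
move=> d1_gt0 d2_gt0 [Mg Mh] [Ng Nh].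
have [gen gg hh [r gh]] := gensP.
rewrite -(add1_repr Mg Ng) -(add1_repr Mh Nh).
by apply: (loewy_length_eq k_char2 gen gg hh gh); rewrite muln_gt0 d1_gt0.
Qed.

Lemma tensor_loewy_length_ext d1 d1' d2 (M : kD d1) (M' : kD d1') (N : kD d2)
    (fM : gen -> 'M_d1) (fM' : gen -> 'M_d1') (fN : gen -> 'M_d2) :
  (0 < d1)%N -> (0 < d1')%N -> (0 < d2)%N ->
  XY_act g h M fM -> XY_act g h M' fM' -> XY_act g h N fN ->
  (forall n, loewy_le (1 + tprod (1 + fM X) (1 + fN X)) (1 + tprod (1 + fM Y)
    (1 + fN Y)) n <->
     loewy_le (1 + tprod (1 + fM' X) (1 + fN X)) (1 + tprod (1 + fM' Y) (1 + fN
       Y)) n) ->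
  'l(M ⊗ N) = 'l(M' ⊗ N).
Proof.
move=> d1_gt0 d1'_gt0 d2_gt0 [Mg Mh] [Mg' Mh'] [Ng Nh].
have [gen gg hh [r gh]] := gensP.
rewrite -(add1_repr Mg Ng) -(add1_repr Mh Nh) -(add1_repr Mg' Ng) -(add1_repr
  Mh' Nh).
by apply: (loewy_length_ext k_char2 gen gg hh gh);
  rewrite muln_gt0 ?d1_gt0 ?d1'_gt0.
Qed.

End Dihedral.

Local Close Scope ring_scope.

Theorem theorem8 (k : fieldType) (k_char2 : 2%N \in [pchar k]%R)
  (q : nat) (q_2power : 2.-nat q) (q_ge2 : 2 <= q)
  (g h : 'D_(4 * q)) (gh_gen : dihedral_generators g h)
  (l m l1 l2 m1 m2 : nat)
  (l1_gt0 : 0 < l1) (l2_gt0 : 0 < l2) (m1_gt0 : 0 < m1) (m2_gt0 : 0 < m2)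
  (l_W' : in_W' (A_ l1 ++ word_inv (B_ l2)))
  (m_W' : in_W' (A_ m1 ++ word_inv (B_ m2)))
  (rho sigma : k) (rho_neq0 : (rho != 0)%R) (sigma_neq0 : (sigma != 0)%R) :
  let kD d := mx_representation k ('D_(4 * q))%G d in
  let wl := A_ l1 ++ word_inv (B_ l2) in
  let wm := A_ m1 ++ word_inv (B_ m2) in
  [/\ (* string with string *)
      (forall (M : kD (size (A_ l)).+1) (N : kD (size (B_ m)).+1),
         is_string_module g h M -> is_string_module g h N ->
         (perp l m ->
            'l(M ⊗ N) = 1 + sharp l m /\ 1 + sharp l m = 1 + l + m) /\
         (~ perp l m -> 'l(M ⊗ N) = 2 + sharp l m))
      /\
      (forall (M : kD (size (A_ l)).+1) (N : kD (size (A_ m)).+1),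
         is_string_module g h M -> is_string_module g h N ->
         let low_digits_0 := forall t, t < carry_bound l m - 1 ->
                               digit l t = 0 /\ digit m t = 0 in
         (low_digits_0 -> 'l(M ⊗ N) = 1 + sharp l m) /\
         (~ low_digits_0 -> 'l(M ⊗ N) = 2 + sharp l m)),
      (* band with string *)
      (forall (M : kD (size wl)) (M' : kD (size wl).+1)
              (N : kD (size (A_ m)).+1),
         is_band_module g h rho M -> is_string_module g h M' ->
         is_string_module g h N ->
         let special := [/\ rho = 1%R, l1 = l2, perp l1 m & perp_pred l1 m] in
         (special -> 'l(M ⊗ N) = 2 + sharp (l1 - 1) m) /\
         (~ special -> 'l(M ⊗ N) = 'l(M' ⊗ N))),
      (* band with band, l1 <> l2 *)
      (forall (M : kD (size wl)) (M' : kD (size wl).+1) (N : kD (size wm)),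
         is_band_module g h rho M -> is_string_module g h M' ->
         is_band_module g h sigma N ->
         l1 <> l2 -> 'l(M ⊗ N) = 'l(M' ⊗ N))
    & (* band with band, l1 = l2 and m1 = m2 *)
      (forall (M : kD (size wl)) (N : kD (size wm)),
         is_band_module g h rho M -> is_band_module g h sigma N ->
         l1 = l2 -> m1 = m2 ->
         [/\ ~ perp l1 m1 -> ~ perp l1 (m1 - 1) -> ~ perp (l1 - 1) m1 ->
               'l(M ⊗ N) = 2 + sharp (l1 - 1) (m1 - 1) /\
               2 + sharp (l1 - 1) (m1 - 1) = 2 + sharp l1 m1,
             perp l1 m1 -> perp (l1 - 1) m1 ->
               'l(M ⊗ N) = if sigma == 1%R then 2 + sharp (l1 - 1) (m1 - 1)
                           else l1 + m1 + 1,
             perp l1 m1 -> perp l1 (m1 - 1) ->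
               'l(M ⊗ N) = if rho == 1%R then 2 + sharp (l1 - 1) (m1 - 1)
                           else l1 + m1 + 1
           & perp (l1 - 1) m1 -> perp l1 (m1 - 1) ->
               'l(M ⊗ N) = if (rho == 1%R) && (sigma == 1%R)
                           then 2 + sharp (l1 - 1) (m1 - 1)
                           else if rho == sigma then l1 + m1
                           else l1 + m1 + 1])].
Proof.
move=> kD wl wm.
have sz_wl : size wl = l1 + l2 by case: (two_armed_word_AB l1 l2).
have sz_wm : size wm = m1 + m2 by case: (two_armed_word_AB m1 m2).
have wl_gt0 : 0 < size wl by rewrite sz_wl; lia.
have wm_gt0 : 0 < size wm by rewrite sz_wm; lia.
have ll d1 d2 (M : kD d1) (N : kD d2) fM fN n :=
  @tensor_loewy_length k k_char2 q q_2power g h gh_gen d1 d2 M N fM fN n.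
have tP d1 d2 := tprod_tensor_like k d1 d2.
have tP' d1 d2 := tensor_swap (tP d1 d2).
have strA n := uniserial_facts k (two_armed_word_A n).
have strB n := uniserial_facts k (two_armed_word_B n).
split; first split.
- move=> M N Mg Ng.
  have [xx yy xyl _ [e [xe Ae]]] := strA l.
  have [yy2 xx2 yxm _ [e2 [ye Be]]] := strB m.
  have [Bm _ aB] := uniserial_alpha k_char2 yy2 xx2 yxm ye Be.
  (* The factors are exchanged: [M(B_m)] supplies the nonzero B-word, [M(A_l)] the vector killed by
     X. *)
  have eqn := loewy_eq_string k_char2 (tP' _ _) xx2 yy2 xx yy (loewy_leC yxm) xyl
    xe Ae aB (fun=> Bm).
  split=> [lm|nlm].
    have o : orth m l by rewrite orthC; apply/perpP.
    rewrite o in eqn; rewrite (sharp_perp lm) add1n.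
    by split; [rewrite (ll _ _ _ _ _ _ _ _ _ Mg Ng eqn) // addnC|].
  have o : orth m l = false by rewrite orthC; apply/negbTE/negP => /perpP.
  rewrite o sharpC in eqn.
  exact: (ll _ _ _ _ _ _ _ _ _ Mg Ng eqn).
- move=> M N Mg Ng low.
  have [xx yy xyl Bl [e [xe Ae]]] := strA l.
  have [xx2 yy2 xym Bm [e2 [xe2 Ae2]]] := strA m.
  have [two none] := loewy_eq_uniserial k_char2 (tP _ _) xx yy xx2 yy2 xyl xym
    xe2 Ae2 xe Ae Bl Bm.
  split=> [/low_digitsP/none|nlow] .
    by move=> eqn; apply: (ll _ _ _ _ _ _ _ _ _ Mg Ng eqn).
  apply: (ll _ _ _ _ _ _ _ _ _ Mg Ng) => //; apply: two.
  by apply: contrapT => /low_digitsP.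
- move=> M M' N Mg Mg' Ng special.
  have [xx2 yy2 xym _ [e [xe Ae]]] := strA m.
  have [l12|ne] := eqVneq l1 l2; last first.
    split=> [[_ /eqP]|_]; first by rewrite (negPf ne).
    apply: (tensor_loewy_length_ext k_char2 q_2power gh_gen _ _ _ Mg Mg' Ng) =>
      // n.
    apply: (band_string_loewy k_char2 _ _ _ (two_armed_word_AB l1 l2)) => //.
    exact/eqP.
  have wP : two_armed_word wl l1 l1 X Y by rewrite {2}l12; apply: two_armed_word_AB.
  have [xx yy xyl Bl Al] := band_facts wP l1_gt0 rho_neq0.
  have [xx' yy' xyl' Bl' al'] := double_string_facts k_char2 wP l1_gt0.
  have eqn' := loewy_eq_string k_char2 (tP _ _) xx' yy' xx2 yy2 xyl' xym xe Ae
    al' (fun=> Bl').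
  have lenM' := ll _ _ _ _ _ _ _ _ _ Mg' Ng eqn'.
  have al := alphaX_socle (@mx_addxx _ k_char2 _) xx yy xyl l1_gt0.
  rewrite Al -{1}[alt_word _ _ l1]GRing.scale1r -GRing.scalerDl in al.
  have [rho1|rho1] := eqVneq rho 1%R.
    have al0 : (alpha (band_mx wl rho X) (band_mx wl rho Y) ^+ l1 = 0)%R.
      by rewrite al {1}rho1 GRing.addrr_pchar2 // GRing.scale0r.
    have eqn := loewy_eq_band_string k_char2 (tP _ _) xx yy xx2 yy2 xyl xym xe Ae
      l1_gt0 Bl al0.
    have lenM := ll _ _ _ _ _ _ _ _ _ Mg Ng eqn.
    (* For [rho = 1] and [l1 = l2] the band value is the same in both clauses; outside the special
       case it must still be matched with the string value. *)
    rewrite lenM ?lenM' // subn1; split=> // nspecial.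
    rewrite sharp_pred_orth // => -[/perpP o [m_gt0 /perpP o']].
    by case: nspecial.
  split=> [[/eqP]|_]; first by rewrite (negPf rho1).
  have al0 : (alpha (band_mx wl rho X) (band_mx wl rho Y) ^+ l1 != 0)%R.
    rewrite al GRing.scaler_eq0 negb_or Bl andbT GRing.addr_eq0.
    by rewrite GRing.oppr_pchar2 // eq_sym.
  have eqn := loewy_eq_string k_char2 (tP _ _) xx yy xx2 yy2 xyl xym xe Ae al0
    (fun=> Bl).
  by rewrite lenM' // (ll _ _ _ _ _ _ _ _ _ Mg Ng eqn).
- move=> M M' N Mg Mg' Ng ne.
  apply: (tensor_loewy_length_ext k_char2 q_2power gh_gen _ _ _ Mg Mg' Ng) => // n.
  exact: (band_string_loewy k_char2 _ _ _ (two_armed_word_AB l1 l2)).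
move=> M N Mg Ng l12 m12.
have wP : two_armed_word wl l1 l1 X Y by rewrite {2}l12; apply: two_armed_word_AB.
have wP' : two_armed_word wm m1 m1 X Y by rewrite {2}m12; apply: two_armed_word_AB.
have [xx yy xyl Bl Al] := band_facts wP l1_gt0 rho_neq0.
have [xx2 yy2 xym Bm Am] := band_facts wP' m1_gt0 sigma_neq0.
have len n := ll _ _ _ _ _ _ n wl_gt0 wm_gt0 Mg Ng.
rewrite !subn1; split.
- move=> /(introN (perpP _ _)) o _ /(introN (perpP _ _)) o'.
  have [E eqn] := loewy_eq_bands_nonorth k_char2 (tP _ _) xx yy xx2 yy2 xyl xym
    l1_gt0 m1_gt0 Bl Bm o o'.
  by rewrite E (len _ eqn).
- move=> /perpP o /perpP o'.
  have eqn := loewy_eq_bands_orth k_char2 (tP _ _) xx yy xx2 yy2 xyl xym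
    l1_gt0 m1_gt0 Bl Bm Am o o'.
  by rewrite (len _ eqn); case: ifP => // _; rewrite addn1.
(* The mirror image of the previous case, with factors and parameters exchanged. *)
- move=> /perpP o /perpP o'; rewrite orthC in o; rewrite orthC in o'.
  have eqn := loewy_eq_bands_orth k_char2 (tP' _ _) xx2 yy2 xx yy xym xyl
    m1_gt0 l1_gt0 Bm Bl Al o o'.
  by rewrite (len _ eqn); case: ifP => // _; rewrite ?addn1 1?sharpC // addnC.
move=> /perpP o /perpP o'.
have eqn := loewy_eq_bands_eq k_char2 (tP _ _) xx yy xx2 yy2 xyl xym
  l1_gt0 m1_gt0 Bl Al Bm Am o o'.
by rewrite (len _ eqn); case: ifP => // _; case: ifP => // _; lia.
Qed.
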